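(* Let $d\ge 1$ and $p\ge 2$ be integers, let $\omega\in\mathbb{R}^d$ have nonzero components, and let $s\ge 0$. Fix initial data $u_0\in A_s^+(\mathbb{T}^d)$ and let $u(t)$ be the solution of $i u_t=\triangle u+u^p$ on $\mathbb{T}^d$ with $u(0)=u_0$. Let $J=(-T_{min},T_{max})$ denote its maximal interval of existence, and let $a_n:J\to\mathbb{C}$, $n\in\mathbb{N}^d$, be the functions such that $$u(t,x)=\sum_{n\in\mathbb{N}^d}a_n(t)e^{i\omega n x}\qquad\text{for all }t\in J.$$ Then each function $a_n(t)$ may be solved for explicitly by quadrature.
   Context: $\mathbb{N}$ denotes the non-negative integers. $\mathbb{T}^d=\prod_{i=1}^d\mathbb{R}/\frac{2\pi}{\omega_i}\mathbb{Z}$. For $n\in\mathbb{Z}^d$: $|n|=|n_1|+\dots+|n_d|$, $\omega n x=\sum_{k=1}^d\omega_k n_k x_k$, and $\omega^2n^2=\sum_{k=1}^d\omega_k^2n_k^2$. For $u\in L^1(\mathbb{T}^d)$, $\hat u(n)=\frac{1}{\mathrm{vol}(\mathbb{T}^d)}\int_{\mathbb{T}^d}u(x)e^{-i\omega n x}dx$ and $\|u\|=\sum_{n\in\mathbb{Z}^d}(1+|n|)^s|\hat u(n)|$. The weighted Wiener algebra is $A_s(\mathbb{T}^d)=\{u\in L^1(\mathbb{T}^d):\|u\|<\infty\}$ (a Banach algebra under pointwise multiplication), and $A_s^+(\mathbb{T}^d)=\{u\in A_s(\mathbb{T}^d):\hat u(n)\ne 0\text{ only if }\min_i n_i\ge 0\}$.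 The PDE is locally well-posed on $A_s(\mathbb{T}^d)$ and $A_s^+(\mathbb{T}^d)$ is invariant. A solution on an interval $J\ni 0$ means $u\in C^0(J,A_s(\mathbb{T}^d))$ satisfying Duhamel's formula, i.e. for every $n$ and $t\in J$, $\widehat{u(t)}(n)=e^{i\omega^2n^2t}\hat u_0(n)-i\int_0^te^{i\omega^2n^2(t-\tau)}\widehat{u(\tau)^p}(n)\,d\tau$. ''Solved for explicitly by quadrature'' means expressible in terms of elementary functions and (iterated) definite integrals of already known functions: $a_n$ belongs to the smallest class of continuous functions $J\to\mathbb{C}$ that contains the constants and $t\mapsto t$ and is closed under sums, products, quotients with nonvanishing denominator, $f\mapsto e^f$, continuous branches of logarithms and of integer roots of nonvanishing functions, and $f\mapsto\left(t\mapsto\int_0^tf(\tau)d\tau\right)$. *)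

(* Defs.v *)
From HB Require Import structures.
From mathcomp Require Import all_boot all_order all_algebra.
From mathcomp Require Import complex.
From mathcomp Require Import all_classical all_reals all_analysis.
From mathcomp.analysis.showcase Require Import summability.

Set Implicit Arguments.
Unset Strict Implicit.
Unset Printing Implicit Defensive.
Import Order.TTheory GRing.Theory Num.Theory.
Import numFieldNormedType.Exports.
Local Open Scope classical_set_scope.
Local Open Scope ring_scope.
Local Open Scope complex_scope.

(* [measurableTypeR R] is [R] with the Borel sigma-algebra on which
   [lebesgue_measure] is defined; tuples carry the product sigma-algebra. *)
Notation euclid R d := (d.-tuple (measurableTypeR R)).

Section lebesgue_cons.
Context (R : realType) (d : nat).
Variable mu : {sigma_finite_measure set (euclid R d) -> \bar R}.

Definition tuple_of_pair (z : measurableTypeR R * euclid R d) :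
  euclid R d.+1 := [tuple of z.1 :: z.2].

Lemma measurable_tuple_of_pair : measurable_fun setT tuple_of_pair.
Proof. exact: measurable_cons. Qed.

Definition lebesgue_cons : set (euclid R d.+1) -> \bar R :=
  pushforward (@lebesgue_measure R \x mu)%E tuple_of_pair.

Let lebesgue_cons0 : lebesgue_cons set0 = 0%E.
Proof. by rewrite /lebesgue_cons /pushforward preimage_set0 measure0. Qed.

Let lebesgue_cons_ge0 A : (0 <= lebesgue_cons A)%E.
Proof. exact: (measure_ge0 (@lebesgue_measure R \x mu)%E). Qed.

Let lebesgue_cons_sigma_additive : semi_sigma_additive lebesgue_cons.
Proof.
move=> F mF tF mUF; rewrite /lebesgue_cons /pushforward preimage_bigcup.
have mpre A : measurable A -> measurable (tuple_of_pair @^-1` A).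
  by move=> mA; rewrite -[X in measurable X]setTI; exact: measurable_tuple_of_pair.
apply: (measure_semi_sigma_additive (s := (@lebesgue_measure R \x mu)%E)).
- by move=> n; exact: mpre.
- apply/trivIsetP => /= i j _ _ ij; rewrite -preimage_setI.
  by move/trivIsetP : tF => /(_ _ _ _ _ ij) ->//; rewrite preimage_set0.
- by rewrite -preimage_bigcup; exact: mpre.
Qed.

HB.instance Definition _ := isMeasure.Build _ _ _ lebesgue_cons
  lebesgue_cons0 lebesgue_cons_ge0 lebesgue_cons_sigma_additive.

Let lebesgue_cons_sigma_finite : sigma_finite setT lebesgue_cons.
Proof.
have /sigma_finiteP[F [TF ndF Foo]] := sigma_finiteT (@lebesgue_measure R).
have /sigma_finiteP[G [TG ndG Goo]] := sigma_finiteT mu.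
pose h (x : euclid R d.+1) : euclid R d := [tuple of behead x].
pose E n := [set x : euclid R d.+1 | F n (thead x) /\ G n (h x)].
have preE n : tuple_of_pair @^-1` E n = F n `*` G n.
  apply/seteqP; split=> -[x y]; rewrite /E /h /tuple_of_pair/= theadE.
    by move=> [Fx]; rewrite (_ : tuple _ = y)//; exact/val_inj.
  by move=> [Fx]; rewrite (_ : tuple _ = y)//; exact/val_inj.
exists E => [|n].
  apply/esym; rewrite -subTset => x _.
  have [i _ Fi] : (\bigcup_n F n) (thead x) by rewrite -TF.
  have [j _ Gj] : (\bigcup_n G n) (h x) by rewrite -TG.
  exists (maxn i j) => //; split.
    by move: Fi; exact/subsetPset/ndF/leq_maxl.
  by move: Gj; exact/subsetPset/ndG/leq_maxr.
have [mFn Fn] := Foo n; have [mGn Gn] := Goo n; split.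
  rewrite (_ : E n = (fun x => thead x) @^-1` F n `&` h @^-1` G n)//.
  apply: measurableI; rewrite -[X in measurable X]setTI.
    exact: (measurable_tnth ord0).
  exact: measurable_behead.
rewrite /lebesgue_cons /pushforward preE product_measure1E//.
by rewrite lte_mul_pinfty// ge0_fin_numE.
Qed.

HB.instance Definition _ := Measure_isSigmaFinite.Build _ _ _ lebesgue_cons
  lebesgue_cons_sigma_finite.

End lebesgue_cons.

(* Lebesgue measure on R^d *)
Fixpoint lebesgue_euclid (R : realType) (d : nat) :
    {sigma_finite_measure set (euclid R d) -> \bar R} :=
  if d is d'.+1 then lebesgue_cons (lebesgue_euclid R d')
  else \d_([tuple] : euclid R 0).

Section complex_analysis.
Context {R : realType}.

Definition cexp (z : R[i]) : R[i] :=
  (expR (complex.Re z))%:C * (cos (complex.Im z) +i* sin (complex.Im z)).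

Definition cintegrable disp (T : measurableType disp)
    (mu : {measure set T -> \bar R}) (D : set T) (f : T -> R[i]) :=
  mu.-integrable D (fun x => (complex.Re (f x))%:E) /\
  mu.-integrable D (fun x => (complex.Im (f x))%:E).

Definition cintegral disp (T : measurableType disp)
    (mu : {measure set T -> \bar R}) (D : set T) (f : T -> R[i]) : R[i] :=
  (\int[mu]_(x in D) complex.Re (f x)) +i* (\int[mu]_(x in D) complex.Im (f x)).

(* the integral of [f] from [0] to [t], for [t] of either sign *)
Definition integral0 (f : R -> R[i]) (t : R) : R[i] :=
  if 0 <= t then cintegral lebesgue_measure `[0, t] f
  else - cintegral lebesgue_measure `[t, 0] f.

End complex_analysis.

Section torus.
Context {R : realType} {d : nat}.
Variable w : d.-tuple R.
Implicit Types (n : d.-tuple int) (x : euclid R d) (u : euclid R d -> R[i]).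

(* Functions on the torus are functions on R^d that are (2 pi / w_i)-periodic
   in the i-th variable; elements of L^1 are given by representatives, which
   may be taken Borel measurable. *)
Definition period (i : 'I_d) : R := 2 * pi / tnth w i.

Definition translate (i : 'I_d) x : euclid R d :=
  [tuple tnth x j + (if j == i then period i else 0) | j < d].

Definition periodic u := forall i x, u (translate i x) = u x.

Definition fundamental_domain : set (euclid R d) :=
  [set x | forall i, 0 <= tnth x i < `|period i|].

Definition torus_volume : R := \prod_(i < d) `|period i|.

Definition L1_torus u :=
  periodic u /\ cintegrable (lebesgue_euclid R d) fundamental_domain u.

Definition freq n x : R :=
  \sum_(k < d) tnth w k * (tnth n k)%:~R * tnth x k.

Definition freq2 n : R := \sum_(k < d) tnth w k ^+ 2 * (tnth n k)%:~R ^+ 2.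

Definition fourier u n : R[i] :=
  (torus_volume^-1)%:C *
  cintegral (lebesgue_euclid R d) fundamental_domain
    (fun x => u x * cexp (- 'i%C * (freq n x)%:C)).

Definition size1 n : nat := (\sum_(k < d) `|tnth n k|)%N.

Definition wiener_norm (s : R) u : \bar R :=
  (\esum_(n in [set: d.-tuple int])
     ((1 + (size1 n)%:R) `^ s * complex.Re `|fourier u n|)%:E)%E.

Definition wiener (s : R) u := L1_torus u /\ (wiener_norm s u < +oo)%E.

Definition wiener_plus (s : R) u :=
  wiener s u /\ (forall n, fourier u n != 0 -> forall i, 0 <= tnth n i).

(* [u t x] solves i u_t = Laplace(u) + u^p on [J] with initial data [u0]; the
   initial condition is Duhamel's formula at [t = 0] *)
Definition solution (p : nat) (s : R) (u0 : euclid R d -> R[i]) (J : set R)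
    (u : R -> euclid R d -> R[i]) :=
  [/\ is_interval J /\ J 0,
      forall t, J t -> wiener s (u t),
      forall t0, J t0 ->
        wiener_norm s (fun x => u t x - u t0 x)
          @[t --> within J (nbhs t0)] --> 0%E
    & forall n t, J t ->
        fourier (u t) n =
          cexp ('i%C * (freq2 n * t)%:C) * fourier u0 n
          - 'i%C * integral0 (fun tau => cexp ('i%C * (freq2 n * (t - tau))%:C) *
                              fourier (fun x => u tau x ^+ p) n) t].

Definition maximal_solution (p : nat) (s : R) (u0 : euclid R d -> R[i])
    (J : set R) (u : R -> euclid R d -> R[i]) :=
  solution p s u0 J u /\
  forall J' v, solution p s u0 J' v -> J' `<=` J.

(* u(x) = sum over N^d of b_n e^{i w n x}, for almost every x, the sum being
   unordered (limit over the finite subsets of N^d) *)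
Definition power_fourier_sum (b : d.-tuple nat -> R[i]) u :=
  {ae lebesgue_euclid R d, forall x, fundamental_domain x ->
     partial_sum (fun n : d.-tuple nat =>
       b n * cexp ('i%C * (freq (map_tuple Posz n) x)%:C))
       @ totally --> (u x : R[i]^o)}.

End torus.

(* Functions on [J] are represented by functions on [R] of which only the
   values on [J] matter (constructor [quad_ext]). *)
Inductive quadrature (R : realType) (J : set R) : (R -> R[i]) -> Prop :=
| quad_cst c : quadrature J (fun=> c)
| quad_id : quadrature J (fun t => t%:C)
| quad_add f g : quadrature J f -> quadrature J g ->
    quadrature J (fun t => f t + g t)
| quad_mul f g : quadrature J f -> quadrature J g ->
    quadrature J (fun t => f t * g t)
| quad_div f g : quadrature J f -> quadrature J g ->
    (forall t, J t -> g t != 0) -> quadrature J (fun t => f t / g t)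
| quad_exp f : quadrature J f -> quadrature J (fun t => cexp (f t))
| quad_log f g : quadrature J f -> (forall t, J t -> f t != 0) ->
    {within J, continuous (g : R -> R[i]^o)} -> (forall t, J t -> cexp (g t) = f t) ->
    quadrature J g
| quad_root k f g : quadrature J f -> (forall t, J t -> f t != 0) ->
    (0 < k)%N -> {within J, continuous (g : R -> R[i]^o)} ->
    (forall t, J t -> g t ^+ k = f t) -> quadrature J g
| quad_integral f : quadrature J f -> quadrature J (integral0 f)
| quad_ext f g : quadrature J f -> (forall t, J t -> g t = f t) ->
    quadrature J g.

(* Main.v *)
(* Since the spectrum of u(t) lies in N^d, the Fourier coefficient of u(t)^p at n
   is a finite convolution sum over the modes k <= n, and Duhamel's formula
   becomes a triangular system of ordinary differential equations
     a_n' = i omega^2 n^2 a_n - i [a^{*p}]_n.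
   The zero mode solves a_0' = - i a_0^p: either it vanishes identically, or it
   has no zero and a_0^(1-p) is affine in t, so that a_0 is a (p-1)-th root of a
   quotient. For n <> 0 the unknown a_n occurs in [a^{*p}]_n only through
   p a_0^(p-1) a_n, hence variation of constants expresses a_n by quadratures of
   modes of smaller degree.
   To identify a_n(t) with a Fourier coefficient, note that unordered convergence
   of the series at one single point is absolute convergence of the a_n(t), so
   that the series converges uniformly almost everywhere. *)
Require Import Defs.
From mathcomp Require Import all_boot all_order all_algebra.
From mathcomp Require Import finmap complex.
From mathcomp Require Import all_classical all_reals all_analysis measurable_realfun.
From mathcomp.analysis.showcase Require Import summability.
From mathcomp Require Import ring lra.

Set Implicit Arguments.
Unset Strict Implicit.
Unset Printing Implicit Defensive.
Import Order.TTheory GRing.Theory Num.Theory.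
Import numFieldNormedType.Exports.
Local Open Scope classical_set_scope.
Local Open Scope ring_scope.
Local Open Scope complex_scope.

(** * Integrals of cosines over boxes *)

Section box.
Context {R : realType}.
Implicit Types (d : nat).

Definition box d (l : 'I_d -> R) : set (euclid R d) :=
  [set x | forall i, 0 <= tnth x i < l i].

Definition dot d (a : 'I_d -> R) (x : euclid R d) : R :=
  \sum_(k < d) a k * tnth x k.

Lemma measurable_box d (l : 'I_d -> R) : measurable (box l).
Proof.
rewrite (_ : box l =
    \bigcap_(i in [set: 'I_d]) ((fun x : euclid R d => tnth x i) @^-1` `[0, l i[)).
  apply: fin_bigcap_measurable => // i _.
  by rewrite -[X in measurable X]setTI; apply: measurable_tnth.
apply/seteqP; split => x; rewrite /box/= => xl i.
  by move=> _; rewrite /= in_itv/= xl.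
by move: (xl i I); rewrite /= in_itv.
Qed.

Lemma measurable_dot d (a : 'I_d -> R) : measurable_fun [set: euclid R d] (dot a).
Proof.
apply: measurable_sum => k; apply: measurable_funM => //.
exact: measurable_tnth.
Qed.

Lemma preimage_box d (l : 'I_d.+1 -> R) :
  @tuple_of_pair R d @^-1` box l = `[0, l ord0[ `*` box (l \o lift ord0).
Proof.
apply/seteqP; split => -[x y]; rewrite /box/=.
  move=> H; split; first by have := H ord0; rewrite in_itv/=.
  by move=> i; have := H (lift ord0 i); rewrite tnthS.
rewrite in_itv/= => -[H0 H] i; case: (unliftP ord0 i) => [j ->|->//].
by have := H j; rewrite tnthS.
Qed.

Lemma dot_cons d (a : 'I_d.+1 -> R) x y :
  dot a (tuple_of_pair (x, y)) = a ord0 * x + dot (a \o lift ord0) y.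
Proof.
rewrite /dot big_ord_recl; congr (_ + _); apply: eq_bigr => i _.
by rewrite /tuple_of_pair tnthS.
Qed.

Lemma lebesgue_itv0 (l : R) : 0 <= l ->
  lebesgue_measure (`[0, l[%classic : set (measurableTypeR R)) = l%:E.
Proof.
move=> l0; rewrite lebesgue_measure_itv/= lte_fin.
case: ifPn => [_|]; first by rewrite -EFinB subr0.
by rewrite lt_neqAle l0 andbT negbK => /eqP <-.
Qed.

Lemma lebesgue_box d (l : 'I_d -> R) : (forall i, 0 <= l i) ->
  lebesgue_euclid R d (box l) = (\prod_(i < d) l i)%:E.
Proof.
elim: d l => [|d IH] l l0 /=.
  rewrite big_ord0 (_ : box l = setT) ?diracT//.
  by apply/seteqP; split => // x _ [].
rewrite /lebesgue_cons /pushforward preimage_box product_measure1E//;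
  last exact: measurable_box.
rewrite [X in (X * _)%E](lebesgue_itv0 (l0 ord0)) IH; last by move=> i; exact: l0.
by rewrite big_ord_recl -EFinM.
Qed.

Lemma measurable_cos_dot d (a : 'I_d -> R) c :
  measurable_fun [set: euclid R d] (fun x => cos (c + dot a x)).
Proof.
apply: (measurableT_comp (continuous_measurable_fun (@continuous_cos R))).
by apply: (measurable_funD (measurable_cst c)); exact: measurable_dot.
Qed.

(** The primitive [a^-1 * sin (c + a * x)] takes the same value at both ends, since [a * l] is a
    whole number of turns. *)
Lemma integral_cos_itv (a l c : R) (z : int) : a != 0 -> 0 < l ->
  a * l = z%:~R * (2 * pi) ->
  (\int[lebesgue_measure]_(x in `[0%R, l[) (cos (c + a * x))%:E = 0)%E.
Proof.
move=> a0 l0 alz.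
have dF x : is_derive x (1 : R) (fun y => a^-1 * sin (c + a * y)) (cos (c + a * x)).
  apply: is_derive_eq => /=.
  by rewrite add0r mul1r /GRing.scale/= mulr1 mulrC mulfK.
have cF x : {for x, continuous (fun y => a^-1 * sin (c + a * y))}.
  by apply: differentiable_continuous; apply/derivable1_diffP; apply: ex_derive.
have sinz (y : R) : sin (y + z%:~R * (2 * pi)) = sin y.
  case: z {alz} => n; first by rewrite mulrC mulr_natr mulr_natl (periodicn (@sinD2pi R)).
  rewrite NegzE mulrNz mulNr mulrC mulr_natr mulr_natl.
  by have := periodicn (@sinD2pi R) n.+1 (y - pi *+ 2 *+ n.+1); rewrite subrK => ->.
have ccos : continuous (fun x => cos (c + a * x)).
  move=> x; apply: continuous_comp; last exact: continuous_cos.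
  by apply: cvgD; [exact: cvg_cst|apply: cvgM; [exact: cvg_cst|exact: cvg_id]].
rewrite integral_itv_bndo_bndc; last first.
  by apply/measurable_EFinP/measurable_funTS; exact: continuous_measurable_fun.
rewrite (@continuous_FTC2 _ _ (fun y => a^-1 * sin (c + a * y)))//.
- by rewrite alz sinz mulr0 addr0 subee.
- exact: continuous_subspaceT.
- split => [x _| |]; first exact: ex_derive.
    by apply: cvg_at_right_filter; exact: cF.
  by apply: cvg_at_left_filter; exact: cF.
- by move=> x _; rewrite derive1E derive_val.
Qed.

(** Induction on the dimension with Fubini, the first coordinate being integrated innermost. The
    free phase [c] absorbs the remaining coordinates, and with a shift by [pi / 2] it lets the same
    statement serve for sines. *)
Lemma integral_cos_box d (a l : 'I_d -> R) c :
  (forall i, 0 < l i) -> (forall i, exists z : int, a i * l i = z%:~R * (2 * pi)) ->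
  (exists i, a i != 0) ->
  (\int[lebesgue_euclid R d]_(x in box l) (cos (c + dot a x))%:E = 0)%E.
Proof.
elim: d a l c => [|d IH] a l c l0 az; first by move=> [[]].
move=> a0.
have mcos : measurable_fun setT (EFin \o (fun x : euclid R d.+1 => cos (c + dot a x))).
  by apply/measurable_EFinP; exact: measurable_cos_dot.
have mE : measurable (`[0, l ord0[ `*` box (l \o lift ord0)
    : set (measurableTypeR R * euclid R d)).
  by apply: measurableX => //; exact: measurable_box.
have icos : (@lebesgue_measure R \x lebesgue_euclid R d)%E.-integrable
   (@tuple_of_pair R d @^-1` box l)
   (EFin \o (fun z => cos (c + dot a (tuple_of_pair z)))).
  rewrite preimage_box; apply: measurable_bounded_integrable => //.
  - rewrite [X in (X < _)%E](_ : _ = (\prod_(i < d.+1) l i)%:E) ?ltry//.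
    rewrite -(@lebesgue_box d.+1); last by move=> i; exact/ltW/l0.
    by rewrite /= /lebesgue_cons /pushforward preimage_box.
  - apply: measurable_funTS.
    by apply: (measurableT_comp (measurable_cos_dot a c)); exact: measurable_tuple_of_pair.
  - exists 1; split => // M M1 x _; apply: le_trans (ltW M1); exact: cos_max.
rewrite /= /lebesgue_cons integral_pushforward//; last 2 first.
  exact: measurable_tuple_of_pair.
  exact: measurable_box.
rewrite integral_mkcond -integral21_prod_meas1; last first.
  by rewrite -integrable_mkcond// preimage_box.
rewrite preimage_box.
have -> : fubini_G lebesgue_measure
   ((EFin \o (fun x : euclid R d.+1 => cos (c + dot a x)) \o @tuple_of_pair R d)
     \_ (`[0, l ord0[ `*` box (l \o lift ord0))) =
   (fun y => \int[lebesgue_measure]_(x in `[0%R, l ord0[)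
      (cos ((c + dot (a \o lift ord0) y) + a ord0 * x))%:E)%E
     \_ (box (l \o lift ord0)).
  apply/funext => y; rewrite /fubini_G patchE; case: ifPn => yb.
    rewrite [RHS]integral_mkcond; apply: eq_integral => x _.
    rewrite !patchE/= in_setX/= yb andbT; case: ifP => // _.
    by rewrite dot_cons addrA addrAC.
  rewrite integral0_eq// => x _; rewrite patchE in_setX/=.
  by rewrite (negbTE yb) andbF.
rewrite -integral_mkcond.
(* If the first frequency is zero, the inner integral is the side length times a cosine in the other
   variables, which the induction hypothesis handles; otherwise the inner integral already vanishes
   for every [y]. *)
have [a00|a00] := eqVneq (a ord0) 0.
  have a0' : exists i, (a \o lift ord0) i != 0.
    case: a0 => i; case: (unliftP ord0 i) => [j ->|->] ai; first by exists j.
    by rewrite a00 eqxx in ai.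
  rewrite (eq_integral (fun y => (l ord0)%:E * (cos (c + dot (a \o lift ord0) y))%:E))%E.
    rewrite integralZl//.
      by rewrite (IH (a \o lift ord0) _ c (fun i => l0 _) (fun i => az _) a0') mule0.
    exact: measurable_box.
    apply: measurable_bounded_integrable.
    - exact: measurable_box.
    - by rewrite [X in (X < _)%E](lebesgue_box (fun i => ltW (l0 (lift ord0 i)))) ltry.
    - by apply: measurable_funTS; exact: measurable_cos_dot.
    - exists 1; split => // M M1 x _; apply: le_trans (ltW M1); exact: cos_max.
  move=> y _.
  under eq_integral do rewrite a00 mul0r addr0.
  by rewrite integral_cst// [X in (_ * X)%E](lebesgue_itv0 (ltW (l0 ord0))) muleC.
rewrite integral0_eq// => y _.
by have [z az0] := az ord0; exact: integral_cos_itv az0.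
Qed.

End box.

(** * Complex-valued functions *)

Section norm1.
Context {R : realType}.
Implicit Types (x y z : R[i]) (t : R).

Lemma cReD x y : complex.Re (x + y) = complex.Re x + complex.Re y.
Proof. by case: x y => ? ? []. Qed.

Lemma cImD x y : complex.Im (x + y) = complex.Im x + complex.Im y.
Proof. by case: x y => ? ? []. Qed.

Lemma cReN x : complex.Re (- x) = - complex.Re x.
Proof. by case: x. Qed.

Lemma cImN x : complex.Im (- x) = - complex.Im x.
Proof. by case: x. Qed.

Lemma cReM x y : complex.Re (x * y) =
  complex.Re x * complex.Re y - complex.Im x * complex.Im y.
Proof. by case: x y => ? ? []. Qed.

Lemma cImM x y : complex.Im (x * y) =
  complex.Re x * complex.Im y + complex.Im x * complex.Re y.
Proof. by case: x y => ? ? []. Qed.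

Lemma cRe_sum I (r : seq I) (P : pred I) (F : I -> R[i]) :
  complex.Re (\sum_(i <- r | P i) F i) = \sum_(i <- r | P i) complex.Re (F i).
Proof. exact: (big_morph _ cReD). Qed.

Lemma cIm_sum I (r : seq I) (P : pred I) (F : I -> R[i]) :
  complex.Im (\sum_(i <- r | P i) F i) = \sum_(i <- r | P i) complex.Im (F i).
Proof. exact: (big_morph _ cImD). Qed.

(** A norm with values in [R], whereas the modulus of a complex number is an element of [R[i]]. It
    lies between the modulus and twice the modulus, which is the source of most factors 2 below. *)
Definition norm1 z : R := `|complex.Re z| + `|complex.Im z|.

Lemma norm1_ge0 z : 0 <= norm1 z.
Proof. by rewrite addr_ge0. Qed.

Lemma norm1_0 : norm1 0 = 0.
Proof. by rewrite /norm1/= normr0 addr0. Qed.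

Lemma norm1_eq0 z : norm1 z = 0 -> z = 0.
Proof.
by case: z => a b /eqP; rewrite paddr_eq0//= !normr_eq0 => /andP[/eqP-> /eqP->].
Qed.

Lemma norm1N z : norm1 (- z) = norm1 z.
Proof. by rewrite /norm1 cReN cImN !normrN. Qed.

Lemma norm1D x y : norm1 (x + y) <= norm1 x + norm1 y.
Proof.
rewrite /norm1 cReD cImD addrACA; apply: lerD; exact: ler_normD.
Qed.

Lemma norm1M x y : norm1 (x * y) <= norm1 x * norm1 y.
Proof.
rewrite /norm1 cReM cImM mulrDl !mulrDr -!normrM.
rewrite (le_trans (lerD (ler_normB _ _) (ler_normD _ _)))//; lra.
Qed.

Lemma norm1_sum I (r : seq I) (P : pred I) (F : I -> R[i]) :
  norm1 (\sum_(i <- r | P i) F i) <= \sum_(i <- r | P i) norm1 (F i).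
Proof.
elim/big_ind2 : _ => [|x a y b xa yb|//]; first by rewrite norm1_0.
exact: le_trans (norm1D _ _) (lerD xa yb).
Qed.

Lemma Re_le_norm1 z : `|complex.Re z| <= norm1 z.
Proof. by rewrite lerDl. Qed.

Lemma Im_le_norm1 z : `|complex.Im z| <= norm1 z.
Proof. by rewrite lerDr. Qed.

Lemma norm1_le_normc z : norm1 z <= 2 * complex.Re `|z|.
Proof.
case: z => a b; rewrite normc_def /norm1/= mulr_natl mulr2n; apply: lerD.
  by rewrite -sqrtr_sqr ler_wsqrtr// lerDl sqr_ge0.
by rewrite -sqrtr_sqr ler_wsqrtr// lerDr sqr_ge0.
Qed.

Lemma normc_le_norm1 z : complex.Re `|z| <= norm1 z.
Proof.
case: z => a b; rewrite normc_def /norm1/=.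
rewrite -[leRHS]ger0_norm ?addr_ge0// -sqrtr_sqr ler_wsqrtr//.
rewrite sqrrD !real_normK ?num_real//.
by rewrite addrAC lerDl mulrn_wge0// mulr_ge0.
Qed.

Definition cis t : R[i] := cos t +i* sin t.

Lemma cisD (s t : R) : cis (s + t) = cis s * cis t.
Proof. by rewrite /cis cosD sinD; simpc; rewrite [_ * _ + _ * _]addrC. Qed.

Lemma cis0 : cis 0 = 1.
Proof. by rewrite /cis cos0 sin0. Qed.

Lemma cisNK t : cis t * cis (- t) = 1.
Proof. by rewrite -cisD subrr cis0. Qed.

Lemma norm1_cis t : norm1 (cis t) <= 2.
Proof. by rewrite [2]/(1 + 1) lerD// ?cos_max ?sin_max. Qed.

Lemma cexp_i t : cexp ('i%C * t%:C) = cis t.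
Proof. by rewrite /cexp; simpc; rewrite /= expR0; simpc. Qed.

Lemma cexp_Ni t : cexp (- 'i%C * t%:C) = cis (- t).
Proof. by rewrite -cexp_i; congr cexp; simpc. Qed.

End norm1.

Section complex_integral.
Context {R : realType} {disp : measure_display} {T : measurableType disp}.
Variables (mu : {measure set T -> \bar R}) (D : set T).
Hypothesis mD : measurable D.
Hypothesis muD : (mu D < +oo)%E.
Implicit Types f g : T -> R[i].

Definition cmeasurable f := measurable_fun D (fun x => complex.Re (f x)) /\
  measurable_fun D (fun x => complex.Im (f x)).

(** Bounds are required almost everywhere only, because the series is assumed to converge to [u]
    only almost everywhere. *)
Definition ae_bounded_by (M : R) f := {ae mu, forall x, D x -> norm1 (f x) <= M}.

Lemma cmeasurable_cst c : cmeasurable (fun=> c).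
Proof. by split; exact: measurable_cst. Qed.

Lemma cmeasurableD f g : cmeasurable f -> cmeasurable g ->
  cmeasurable (fun x => f x + g x).
Proof.
move=> [f1 f2] [g1 g2]; split.
  by under eq_fun do rewrite cReD; exact: measurable_funD.
by under eq_fun do rewrite cImD; exact: measurable_funD.
Qed.

Lemma cmeasurableM f g : cmeasurable f -> cmeasurable g ->
  cmeasurable (fun x => f x * g x).
Proof.
move=> [f1 f2] [g1 g2]; split.
  under eq_fun do rewrite cReM.
  by apply: measurable_funB; exact: measurable_funM.
under eq_fun do rewrite cImM.
by apply: measurable_funD; exact: measurable_funM.
Qed.

Lemma cmeasurableN f : cmeasurable f -> cmeasurable (fun x => - f x).
Proof.
move=> mf; under eq_fun do rewrite -mulN1r.
by apply: cmeasurableM => //; exact: cmeasurable_cst.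
Qed.

Lemma cmeasurable_sum I (r : seq I) (F : I -> T -> R[i]) :
  (forall i, cmeasurable (F i)) -> cmeasurable (fun x => \sum_(i <- r) F i x).
Proof.
move=> mF; elim: r => [|i r IH].
  by under eq_fun do rewrite big_nil; exact: cmeasurable_cst.
by under eq_fun do rewrite big_cons; exact: cmeasurableD.
Qed.

Lemma cintegrable_measurable f : cintegrable mu D f -> cmeasurable f.
Proof.
by move=> [/measurable_int/measurable_EFinP f1 /measurable_int/measurable_EFinP].
Qed.

Lemma ae_bounded_byD M N f g : ae_bounded_by M f -> ae_bounded_by N g ->
  ae_bounded_by (M + N) (fun x => f x + g x).
Proof.
apply: filterS2 => x fM gN Dx.
by apply: le_trans (norm1D _ _) (lerD _ _); [exact: fM|exact: gN].
Qed.

Lemma ae_bounded_byM M N f g : ae_bounded_by M f -> ae_bounded_by N g ->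
  ae_bounded_by (M * N) (fun x => f x * g x).
Proof.
apply: filterS2 => x fM gN Dx.
apply: le_trans (norm1M _ _) _; apply: ler_pM; rewrite ?norm1_ge0//.
  exact: fM.
exact: gN.
Qed.

Lemma ae_bounded_by_everywhere M f : (forall x, D x -> norm1 (f x) <= M) ->
  ae_bounded_by M f.
Proof. by move=> fM; exact: aeW. Qed.

(** The bound has the absolute value of [M] because [M] carries no sign hypothesis: when [D] is
    negligible, a negative [M] is possible. *)
Lemma ae_bounded_integrable M (f : T -> R) : measurable_fun D f ->
  {ae mu, forall x, D x -> `|f x| <= M} -> mu.-integrable D (EFin \o f) /\
  `|\int[mu]_(x in D) f x| <= `|M| * fine (mu D).
Proof.
move=> mf fM.
have mEf : measurable_fun D (EFin \o f) by exact/measurable_EFinP.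
have le : (\int[mu]_(x in D) `|(f x)%:E| <= `|M|%:E * mu D)%E.
  apply: integral_le_bound => //; apply: filterS fM => x + Dx => /(_ Dx) xM.
  by rewrite lee_fin (le_trans xM)// ler_norm.
have fint : mu.-integrable D (EFin \o f).
  by apply/integrableP; split => //; apply: le_lt_trans le _; rewrite lte_mul_pinfty.
split => //; apply: le_trans (le_normr_Rintegral mD fint) _.
rewrite -lee_fin EFinM (@fineK _ (mu D)) ?ge0_fin_numE// fineK//.
by apply: integrable_fin_num => //; apply: integrable_norm.
Qed.

Lemma ae_bounded_cintegrable M f : cmeasurable f -> ae_bounded_by M f ->
  cintegrable mu D f.
Proof.
move=> [f1 f2] fM; split.
  apply: (ae_bounded_integrable f1 (M := M) _).1; apply: filterS fM => x + Dx => /(_ Dx).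
  by apply: le_trans; exact: Re_le_norm1.
apply: (ae_bounded_integrable f2 (M := M) _).1; apply: filterS fM => x + Dx => /(_ Dx).
by apply: le_trans; exact: Im_le_norm1.
Qed.

Lemma norm1_cintegral M f : cmeasurable f -> ae_bounded_by M f ->
  norm1 (cintegral mu D f) <= 2 * `|M| * fine (mu D).
Proof.
move=> [f1 f2] fM; rewrite /norm1/= -mulrA mulr_natl mulr2n; apply: lerD.
  apply: (ae_bounded_integrable f1 (M := M) _).2; apply: filterS fM => x + Dx => /(_ Dx).
  by apply: le_trans; exact: Re_le_norm1.
apply: (ae_bounded_integrable f2 (M := M) _).2; apply: filterS fM => x + Dx => /(_ Dx).
by apply: le_trans; exact: Im_le_norm1.
Qed.

Lemma eq_cintegral f g : (forall x, D x -> f x = g x) ->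
  cintegral mu D f = cintegral mu D g.
Proof.
move=> fg; rewrite /cintegral; congr (_ +i* _); apply: eq_Rintegral => x /set_mem Dx;
  by rewrite fg.
Qed.

Lemma cintegralD f g : cintegrable mu D f -> cintegrable mu D g ->
  cintegral mu D (fun x => f x + g x) = cintegral mu D f + cintegral mu D g.
Proof.
move=> [f1 f2] [g1 g2]; rewrite /cintegral; simpc.
by congr (_ +i* _); rewrite -RintegralD//; apply: eq_Rintegral => x _;
  rewrite ?cReD ?cImD.
Qed.

Lemma cintegrableZ c f : cintegrable mu D f -> cintegrable mu D (fun x => c * f x).
Proof.
move=> [f1 f2]; split.
  under eq_fun do rewrite cReM EFinB !EFinM.
  by apply: integrableB => //; exact: integrableZl.
under eq_fun do rewrite cImM EFinD !EFinM.
by apply: integrableD => //; exact: integrableZl.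
Qed.

Lemma cintegralZ c f : cintegrable mu D f ->
  cintegral mu D (fun x => c * f x) = c * cintegral mu D f.
Proof.
move=> [f1 f2]; case: c => a b.
have i r (h : T -> R) : mu.-integrable D (EFin \o h) ->
  mu.-integrable D (EFin \o (fun x => r * h x)) by move=> hi; exact: (integrableZl mD r hi).
rewrite /cintegral; simpc; congr (_ +i* _).
  rewrite -!RintegralZl// -RintegralB ?i//.
  by apply: eq_Rintegral => x _; rewrite cReM.
rewrite -!RintegralZl// -RintegralD ?i//.
by apply: eq_Rintegral => x _; rewrite cImM.
Qed.

Lemma cintegrableD f g : cintegrable mu D f -> cintegrable mu D g ->
  cintegrable mu D (fun x => f x + g x).
Proof.
move=> [f1 f2] [g1 g2]; split.
  by under eq_fun do rewrite cReD EFinD; exact: integrableD.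
by under eq_fun do rewrite cImD EFinD; exact: integrableD.
Qed.

Lemma cintegral0 : cintegral mu D (fun=> 0) = 0.
Proof. by rewrite /cintegral /Rintegral !integral0. Qed.

Lemma cintegrable0 : cintegrable mu D (fun=> 0).
Proof. by split; exact: integrable0. Qed.

Lemma cintegrable_sum I (r : seq I) (F : I -> T -> R[i]) :
  (forall i, cintegrable mu D (F i)) ->
  cintegrable mu D (fun x => \sum_(i <- r) F i x).
Proof.
move=> iF; elim: r => [|i r IH].
  by under eq_fun do rewrite big_nil; exact: cintegrable0.
by under eq_fun do rewrite big_cons; exact: cintegrableD.
Qed.

Lemma cintegral_sum I (r : seq I) (F : I -> T -> R[i]) :
  (forall i, cintegrable mu D (F i)) ->
  cintegral mu D (fun x => \sum_(i <- r) F i x) =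
  \sum_(i <- r) cintegral mu D (F i).
Proof.
move=> iF; elim: r => [|i r IH].
  by under eq_fun do rewrite big_nil; rewrite big_nil cintegral0.
under eq_fun do rewrite big_cons.
by rewrite big_cons cintegralD ?IH//; exact: cintegrable_sum.
Qed.

End complex_integral.

(** * Unordered sums and Fourier coefficients *)

Section unordered_sums.
Context {R : realType} {I : choiceType}.
Implicit Types (A B : {fset I}) (z : I -> R[i]).

(** Split [B] according to the sign of [g]: on each half the sum of absolute values is the absolute
    value of a sub-sum, hence at most [e]. *)
Lemma sum_abs_le2 (g : I -> R) (e : R) B :
  (forall C : {fset I}, (C `<=` B)%fset -> `|\sum_(i <- C) g i| <= e) ->
  \sum_(i <- B) `|g i| <= 2 * e.
Proof.
move=> ge; rewrite (big_fsetID _ (fun i => 0 <= g i))/= mulr_natl mulr2n.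
apply: lerD.
  rewrite (_ : \sum_(i <- _) `|g i| = \sum_(i <- [fset x in B | 0 <= g x]%fset) g i).
    by apply: le_trans (ler_norm _) (ge _ _); exact: fset_sub.
  by rewrite big_seq [RHS]big_seq; apply: eq_bigr => i; rewrite !inE/= => /andP[_ /ger0_norm].
rewrite (_ : \sum_(i <- _) `|g i| = - \sum_(i <- [fset x in B | ~~ (0 <= g x)]%fset) g i).
  by rewrite (le_trans (ler_norm _))// normrN ge//; exact: fset_sub.
rewrite -sumrN big_seq [RHS]big_seq; apply: eq_bigr => i; rewrite !inE/= -ltNge.
by move=> /andP[_ /ltr0_norm].
Qed.

Lemma sum_norm1_le4 z (e : R) B :
  (forall C : {fset I}, (C `<=` B)%fset -> norm1 (\sum_(i <- C) z i) <= e) ->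
  \sum_(i <- B) norm1 (z i) <= 4 * e.
Proof.
move=> ze; rewrite /norm1 big_split/=.
rewrite (_ : 4 * e = 2 * e + 2 * e); last by ring.
apply: lerD; apply: sum_abs_le2 => C CB.
  by rewrite -cRe_sum (le_trans (Re_le_norm1 _))// ze.
by rewrite -cIm_sum (le_trans (Im_le_norm1 _))// ze.
Qed.

Lemma partial_sumE z A : partial_sum z A = \sum_(i <- A) z i.
Proof. by rewrite /partial_sum -(big_seq_fsetE _ _ xpredT). Qed.

Lemma partial_sum_near z (l : R[i]) (e : R) :
  partial_sum z @ totally --> (l : R[i]^o) -> 0 < e ->
  exists A0, forall A, (A0 `<=` A)%fset -> norm1 (l - \sum_(i <- A) z i) <= e.
Proof.
have FF : Filter (@totally I) by exact: totally_filter.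
move=> zl0 e0.
(* Convergence is stated with the modulus; asking for [e / 2] there pays for the factor 2 in
   [norm1_le_normc]. *)
have zl := (@cvgrPdist_le _ (R[i]^o) _ _ FF (partial_sum z) l).1 zl0.
have e20 : 0 < (e / 2)%:C :> R[i] by rewrite ltcR divr_gt0.
have [A0 _ A0P] := zl _ e20; exists A0 => A A0A.
have := A0P A A0A; rewrite /= partial_sumE => le.
apply: le_trans (norm1_le_normc _) _.
move: le; rewrite lecE => /andP[_ /=].
by rewrite ler_pdivlMr// mulrC.
Qed.

(** Cauchy criterion: a finite set disjoint from [A0] has a sum that is the difference of two
    remainders, each at most [e / 8]. This holds for all its subsets too, so [sum_norm1_le4]
    upgrades it to absolute sums, and 4 (e/8 + e/8) = e. *)
Lemma partial_sum_tail z (l : R[i]) (e : R) :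
  partial_sum z @ totally --> (l : R[i]^o) -> 0 < e ->
  exists A0, forall B, [disjoint A0 & B]%fset -> \sum_(i <- B) norm1 (z i) <= e.
Proof.
move=> zl e0; have e80 : 0 < e / 8 by rewrite divr_gt0.
have [A0 A0P] := partial_sum_near zl e80; exists A0 => B A0B.
rewrite (_ : e = 4 * (e / 8 + e / 8)); last by lra.
apply: sum_norm1_le4 => C CB.
have A0C : [disjoint A0 & C]%fset by exact: fdisjointWr A0B.
have -> : \sum_(i <- C) z i =
    (l - \sum_(i <- A0) z i) - (l - \sum_(i <- (A0 `|` C)%fset) z i).
  rewrite (big_fsetID _ (mem A0) (A0 `|` C)%fset)/=.
  rewrite (_ : [fset x in A0 `|` C | x \in A0]%fset = A0); last first.
    by apply/fsetP => x; rewrite !inE andb_orl andbb orb_idr// => /andP[].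
  rewrite (_ : [fset x in A0 `|` C | x \notin A0]%fset = C); last first.
    apply/fsetP => x; rewrite !inE andb_orl andbN orFb andb_idr// => xC.
    by apply/negP => xA0; have := fdisjointP A0C _ xA0; rewrite xC.
  by ring.
rewrite (le_trans (norm1D _ _))// norm1N lerD// A0P//.
exact: fsubsetUl.
Qed.

End unordered_sums.

(** * Orthogonality of the characters on the torus *)

Section fourier.
Context {R : realType} {d : nat}.
Variable w : d.-tuple R.
Hypothesis w0 : forall i, tnth w i != 0.
Local Notation mu := (lebesgue_euclid R d).
Local Notation D := (fundamental_domain w).
Implicit Types (m : d.-tuple int) (k : d.-tuple nat) (x : euclid R d)
  (u v : euclid R d -> R[i]) (b c : d.-tuple nat -> R[i]).

Lemma period_gt0 i : 0 < `|period w i|.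
Proof. by rewrite normr_gt0 mulf_neq0 ?invr_eq0// mulf_neq0 ?gt_eqF ?pi_gt0. Qed.

Lemma fundamental_domainE : D = box (fun i => `|period w i|).
Proof. by []. Qed.

Lemma measurable_fundamental_domain : measurable D.
Proof. exact: measurable_box. Qed.

Lemma lebesgue_fundamental_domain : mu D = (torus_volume w)%:E.
Proof. by rewrite fundamental_domainE lebesgue_box. Qed.

Lemma lebesgue_fundamental_domain_lty : (mu D < +oo)%E.
Proof. by rewrite lebesgue_fundamental_domain ltry. Qed.

Lemma torus_volume_gt0 : 0 < torus_volume w.
Proof. by apply: prodr_gt0 => i _; exact: period_gt0. Qed.

Lemma measurable_cis_freq m : cmeasurable D (fun x => cis (freq w m x)).
Proof.
split; apply: measurable_funTS.
  apply: (measurableT_comp (continuous_measurable_fun (@continuous_cos R))).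
  exact: measurable_dot.
apply: (measurableT_comp (continuous_measurable_fun (@continuous_sin R))).
exact: measurable_dot.
Qed.

Lemma measurable_cis_freqN m : cmeasurable D (fun x => cis (- freq w m x)).
Proof.
have [c1 c2] := measurable_cis_freq m; split.
  by under eq_fun do rewrite /= cosN.
by under eq_fun do rewrite /= sinN; exact: measurable_funN.
Qed.

Lemma fourierE u m : fourier w u m = (torus_volume w)^-1%:C *
  cintegral mu D (fun x => u x * cis (- freq w m x)).
Proof.
by rewrite /fourier; congr (_ * _); apply: eq_cintegral => x _; rewrite cexp_Ni.
Qed.

Lemma fourier1 m : fourier w (fun=> 1) m = [forall i, tnth m i == 0]%:R.
Proof.
rewrite fourierE; have [/forallP m0|] := boolP [forall i, tnth m i == 0].
  have f0 x : freq w m x = 0.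
    by apply: big1 => i _; rewrite (eqP (m0 i)) mulr0 mul0r.
  rewrite (@eq_cintegral _ _ _ _ _ _ (cst 1)); last first.
    by move=> x _; rewrite mul1r f0 oppr0 cis0.
  have -> : cintegral mu D (cst 1) = (torus_volume w)%:C.
    have mD := measurable_fundamental_domain.
    rewrite /cintegral/= !Rintegral_cst// mul1r mul0r.
    by rewrite [X in fine X]lebesgue_fundamental_domain.
  by rewrite -rmorphM/= mulVf// gt_eqF// torus_volume_gt0.
rewrite negb_forall => /existsP[i mi].
have int0 (e : R) : \int[mu]_(x in D) cos (e + freq w m x) = 0.
  rewrite /Rintegral fundamental_domainE integral_cos_box//.
  - exact: period_gt0.
  (* The side length is the absolute value of the period, so the sign of [tnth w j] enters the
     number of turns. *)
  - move=> j; exists (sgz (tnth w j) * tnth m j).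
    rewrite intrM -sgrEz /period normrM normfV ger0_norm ?mulr_ge0 ?pi_ge0//.
    rewrite -[X in X * _ * _](mulr_sg_norm (tnth w j)).
    by field; rewrite normr_eq0 w0.
  - by exists i; rewrite mulf_neq0 ?intr_eq0.
rewrite [X in _ * X](_ : _ = 0) ?mulr0//.
(* The imaginary part is minus a sine, written as a cosine with phase [pi / 2], so that [int0]
   covers both parts. *)
rewrite (@eq_cintegral _ _ _ _ _ _
  (fun x => cos (0 + freq w m x) +i* cos (pi / 2 + freq w m x))).
  by rewrite /cintegral/= !int0.
by move=> x _; rewrite mul1r /cis cosN sinN add0r [pi / 2 + _]addrC cosDpihalf.
Qed.

End fourier.

(** * Uniform approximation by trigonometric sums and Fourier coefficients of products *)

Section fourier_power.
Context {R : realType} {d : nat}.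
Variable w : d.-tuple R.
Hypothesis w0 : forall i, tnth w i != 0.
Local Notation mu := (lebesgue_euclid R d).
Local Notation D := (fundamental_domain w).
Implicit Types (A : {fset d.-tuple nat}) (m k : d.-tuple nat) (n : d.-tuple int)
  (x : euclid R d)
  (u v : euclid R d -> R[i]) (b : d.-tuple nat -> R[i]).

Definition trig_sum b (A : {fset d.-tuple nat}) x : R[i] :=
  \sum_(k <- A) b k * cis (freq w (map_tuple Posz k) x).

(** The size of the terms does not depend on [x] up to a constant, so the absolute tail bound
    obtained at a single point of convergence controls the tails at all points; [A0] is therefore
    independent of [x]. *)
Lemma trig_sum_uniform b u (e : R) : power_fourier_sum w b u -> 0 < e ->
  exists A0, forall A, (A0 `<=` A)%fset ->
    ae_bounded_by mu D e (fun x => u x - trig_sum b A x).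
Proof.
move=> bu e0; have e20 : 0 < e / 2 by rewrite divr_gt0.
(* A point of convergence exists: otherwise the fundamental domain would be negligible, against its
   positive volume. *)
have [x0 [Dx0 cvx0]] : exists x0, D x0 /\
   partial_sum (fun k => b k * cexp ('i%C * (freq w (map_tuple Posz k) x0)%:C))
     @ totally --> (u x0 : R[i]^o).
  apply: contrapT => /forallNP nx; have D0 : mu.-negligible D.
    by apply: negligibleS bu => x Dx /= /(_ Dx) ?; apply: (nx x).
  have := lebesgue_fundamental_domain w.
  have /(_ D0) := (@measure_negligible _ _ _ mu D (measurable_fundamental_domain w)).
  move=> -> [] /eqP; rewrite lt_eqF//; exact: torus_volume_gt0.
have e80 : 0 < e / 8 by rewrite divr_gt0.
have [A0 A0P] := partial_sum_tail cvx0 e80.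
(* Moving a term from [x0] to [x] multiplies it by two values of [cis], each of [norm1] at most 2;
   hence the factor 4, and 4 (e/8) = e/2. *)
have bB B x : [disjoint A0 & B]%fset ->
    norm1 (\sum_(k <- B) b k * cis (freq w (map_tuple Posz k) x)) <= e / 2.
  move=> /A0P A0B; rewrite (le_trans (norm1_sum _ _ _))//.
  rewrite (_ : e / 2 = 4 * (e / 8)); last by field.
  rewrite (le_trans _ (ler_wpM2l _ A0B))// mulr_sumr; apply: ler_sum => k _.
  rewrite cexp_i; set z := b k * cis (freq w _ x0).
  have -> : b k = z * cis (- freq w (map_tuple Posz k) x0).
    by rewrite /z -mulrA cisNK mulr1.
  rewrite -mulrA (le_trans (norm1M _ _))// mulrC ler_wpM2r ?norm1_ge0//.
  rewrite (le_trans (norm1M _ _))// (_ : 4 = 2 * 2); last by ring.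
  by apply: ler_pM; rewrite ?norm1_ge0 ?norm1_cis.
exists A0 => A A0A; apply: filterS bu => x + Dx => /(_ Dx) cvx.
have [A1 A1P] := partial_sum_near cvx e20.
(* The set [A1] comes from convergence at [x] and depends on [x], but it enters only through the
   part of it outside [A]. That part is disjoint from [A0], where [bB] gives a bound uniform in
   [x]. *)
have -> : u x - trig_sum b A x =
    (u x - trig_sum b (A `|` A1)%fset x) + trig_sum b (A1 `\` A)%fset x.
  rewrite {2}/trig_sum (big_fsetID _ (mem A) (A `|` A1)%fset)/=.
  rewrite (_ : [fset x in A `|` A1 | x \in A]%fset = A); last first.
    by apply/fsetP => y; rewrite !inE andb_orl andbb orb_idr// => /andP[].
  rewrite (_ : [fset x in A `|` A1 | x \notin A]%fset = (A1 `\` A)%fset); last first.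
    by apply/fsetP => y; rewrite !inE andb_orl andbN orFb andbC.
  by rewrite -/(trig_sum b A x) -/(trig_sum b (A1 `\` A)%fset x); ring.
rewrite (le_trans (norm1D _ _))// [leRHS](splitr e) lerD//; last first.
  apply: bB; apply/fdisjointP => y /(fsubsetP A0A) yA.
  by rewrite !inE yA.
rewrite /trig_sum; under eq_bigr do rewrite -cexp_i.
by apply: A1P; exact: fsubsetUr.
Qed.

Lemma cmeasurable_trig_sum b A : cmeasurable D (trig_sum b A).
Proof.
apply: cmeasurable_sum => k; apply: cmeasurableM; first exact: cmeasurable_cst.
exact: measurable_cis_freq.
Qed.

Lemma ae_bounded_trig_sum b A :
  ae_bounded_by mu D (\sum_(k <- A) norm1 (b k) * 2) (trig_sum b A).
Proof.
apply: ae_bounded_by_everywhere => x _; rewrite (le_trans (norm1_sum _ _ _))//.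
apply: ler_sum => k _; rewrite (le_trans (norm1M _ _))// ler_wpM2l ?norm1_ge0//.
exact: norm1_cis.
Qed.

(** Almost everywhere [u] is within 1 of a trigonometric polynomial, which is bounded. *)
Lemma power_fourier_sum_bounded b u : power_fourier_sum w b u ->
  exists M, ae_bounded_by mu D M u.
Proof.
move=> bu; have [A AP] := trig_sum_uniform bu (@ltr01 R).
exists (1 + \sum_(k <- A) norm1 (b k) * 2).
have -> : u = (fun x => u x - trig_sum b A x + trig_sum b A x).
  by apply/funext => x; rewrite subrK.
exact: ae_bounded_byD (AP A (fsubset_refl _)) (ae_bounded_trig_sum b A).
Qed.

Definition int_sub n k : d.-tuple int := [tuple tnth n i - (tnth k i)%:Z | i < d].

Lemma freq_int_sub n k x :
  freq w (int_sub n k) x = freq w n x - freq w (map_tuple Posz k) x.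
Proof.
rewrite /freq -sumrB; apply: eq_bigr => i _.
by rewrite tnth_mktuple tnth_map intrB; ring.
Qed.

Lemma le0_scaled (x C : R) : (forall e, 0 < e -> x <= C * e) -> x <= 0.
Proof.
move=> xC; apply/ler_addgt0Pl => e e0; rewrite addr0.
have C1 : 0 < `|C| + 1 by rewrite ltr_wpDl.
apply: le_trans (xC (e / (`|C| + 1)) _) _; first by rewrite divr_gt0.
rewrite mulrCA ler_piMr ?ltW// ltr_pdivrMr// mul1r.
by rewrite ltr_pwDr// ler_norm.
Qed.

Lemma cintegrable_mul_cis v M n : cmeasurable D v -> ae_bounded_by mu D M v ->
  cintegrable mu D (fun x => v x * cis (- freq w n x)).
Proof.
move=> mv vM; apply: (@ae_bounded_cintegrable _ _ _ _ _
  (measurable_fundamental_domain w) (lebesgue_fundamental_domain_lty w) (M * 2)).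
  by apply: cmeasurableM => //; exact: measurable_cis_freqN.
apply: ae_bounded_byM => //.
by apply: ae_bounded_by_everywhere => x _; exact: norm1_cis.
Qed.

Lemma fourier_trig_sumM b A v M n : cmeasurable D v -> ae_bounded_by mu D M v ->
  fourier w (fun x => trig_sum b A x * v x) n =
  \sum_(k <- A) b k * fourier w v (int_sub n k).
Proof.
move=> mv vM; have mD := measurable_fundamental_domain w.
have iv n' := cintegrable_mul_cis n' mv vM.
rewrite fourierE (@eq_cintegral _ _ _ _ _ _
    (fun x => \sum_(k <- A) b k * (v x * cis (- freq w (int_sub n k) x)))); last first.
  move=> x _; rewrite /trig_sum !mulr_suml; apply: eq_bigr => k _.
  by rewrite freq_int_sub opprB cisD; ring.
rewrite cintegral_sum//; last by move=> k; exact: cintegrableZ.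
rewrite mulr_sumr; apply: eq_bigr => k _.
by rewrite cintegralZ// mulrCA fourierE.
Qed.

(** For a trigonometric sum in place of [u] the formula is [fourier_trig_sumM]. Enlarging the index
    set beyond [A0] adds only zero terms, so the right-hand side stays fixed while the sums approach
    [u] uniformly; the error is a constant times [e]. *)
Lemma fourier_mul b u v M n (A0 : {fset d.-tuple nat}) :
  power_fourier_sum w b u -> cmeasurable D u ->
  cmeasurable D v -> ae_bounded_by mu D M v ->
  (forall k, k \notin A0 -> fourier w v (int_sub n k) = 0) ->
  fourier w (fun x => u x * v x) n =
  \sum_(k <- A0) b k * fourier w v (int_sub n k).
Proof.
move=> bu mu_ mv vM A0P.
have mD := measurable_fundamental_domain w.
have muD := lebesgue_fundamental_domain_lty w.
apply/eqP; rewrite -subr_eq0; apply/eqP/norm1_eq0/le_anti.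
rewrite norm1_ge0 andbT.
(* The constant is the one that [norm1_cintegral] yields: [M] bounds [v], the 2 next to it bounds
   the character, and the outer 2 counts real and imaginary parts. *)
apply: (@le0_scaled _ (norm1 (torus_volume w)^-1%:C * (2 * `|M * 2| * fine (mu D)))) => e e0.
have [A1 A1P] := trig_sum_uniform bu e0.
have := A1P (A0 `|` A1)%fset (fsubsetUr _ _); set A := (A0 `|` A1)%fset => uA.
have -> : \sum_(k <- A0) b k * fourier w v (int_sub n k) =
    \sum_(k <- A) b k * fourier w v (int_sub n k).
  apply: big_fset_incl; first exact: fsubsetUl.
  by move=> k _ kA0; rewrite A0P// mulr0.
rewrite -(fourier_trig_sumM _ _ _ mv vM) !fourierE -mulrBr.
have [N uN] := power_fourier_sum_bounded bu.
have mc := measurable_cis_freqN w n.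
have cM : ae_bounded_by mu D 2 (fun x => cis (- freq w n x)).
  by apply: ae_bounded_by_everywhere => x _; exact: norm1_cis.
have mS := cmeasurable_trig_sum b A.
have -> : cintegral mu D (fun x => u x * v x * cis (- freq w n x)) =
    cintegral mu D (fun x => (u x - trig_sum b A x) * (v x * cis (- freq w n x))) +
    cintegral mu D (fun x => trig_sum b A x * v x * cis (- freq w n x)).
  rewrite -cintegralD//.
  - by apply: eq_cintegral => x _; ring.
  - apply: (ae_bounded_cintegrable mD muD _ (ae_bounded_byM uA (ae_bounded_byM vM cM))).
    apply: cmeasurableM => //; last exact: cmeasurableM.
    by apply: cmeasurableD => //; exact: cmeasurableN.
  - apply: (ae_bounded_cintegrable mD muD _
      (ae_bounded_byM (ae_bounded_byM (ae_bounded_trig_sum b A) vM) cM)).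
    by apply: cmeasurableM => //; exact: cmeasurableM.
rewrite addrK (le_trans (norm1M _ _))// -mulrA ler_wpM2l ?norm1_ge0//.
have mf : cmeasurable D (fun x => (u x - trig_sum b A x) * (v x * cis (- freq w n x))).
  apply: cmeasurableM => //; last exact: cmeasurableM.
  by apply: cmeasurableD => //; exact: cmeasurableN.
have := norm1_cintegral mD muD mf (ae_bounded_byM uA (ae_bounded_byM vM cM)).
move=> /le_trans; apply; rewrite normrM (gtr0_norm e0) le_eqVlt; apply/orP; left; apply/eqP.
by ring.
Qed.

End fourier_power.

(** * Fourier coefficients of powers as finite convolutions *)

Section convolution_power.
Context {R : realType} {d : nat}.
Implicit Types (m k : d.-tuple nat) (b : d.-tuple nat -> R[i]).

(** The componentwise order interval from 0 to [m]. To obtain a finite set it is cut out of the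
    tuples over one ordinal type, whose size, the sum of the entries of [m], dominates every
    entry. *)
Definition below m : {fset d.-tuple nat} :=
  [fset k in [seq map_tuple (@nat_of_ord _) t |
              t : d.-tuple 'I_(\sum_(i < d) tnth m i).+1]
    | [forall i, tnth k i <= tnth m i]%N]%fset.

Lemma in_below m k : (k \in below m) = [forall i, tnth k i <= tnth m i]%N.
Proof.
rewrite !inE/= andb_idl// => /forallP km.
apply/mapP; exists (map_tuple inord k); rewrite ?mem_enum//.
apply: eq_from_tnth => i; rewrite !tnth_map inordK// ltnS.
by rewrite (leq_trans (km i))// (bigD1 i)//= leq_addr.
Qed.

Definition nat_sub m k : d.-tuple nat := [tuple tnth m i - tnth k i | i < d]%N.

(** The coefficient at [m] of the [p]-th power of the formal power series in [d] variables with
    coefficients [b]. *)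
Fixpoint conv_power b p m : R[i] :=
  if p is q.+1 then \sum_(k <- below m) b k * conv_power b q (nat_sub m k)
  else [forall i, tnth m i == 0%N]%:R.

Variable w : d.-tuple R.
Hypothesis w0 : forall i, tnth w i != 0.
Local Notation mu := (lebesgue_euclid R d).
Local Notation D := (fundamental_domain w).
Implicit Types (n : d.-tuple int) (x : euclid R d) (u v : euclid R d -> R[i]).

Definition nonneg n := [forall i, 0 <= tnth n i].

Lemma int_subK m k : k \in below m ->
  int_sub (map_tuple Posz m) k = map_tuple Posz (nat_sub m k).
Proof.
rewrite in_below => /forallP km; apply: eq_from_tnth => i.
by rewrite tnth_mktuple !tnth_map tnth_ord_tuple subzn.
Qed.

Lemma nonnegP n : reflect (exists m, n = map_tuple Posz m) (nonneg n).
Proof.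
apply: (iffP forallP) => [n0|[m -> i]]; last by rewrite tnth_map.
exists (map_tuple absz n); apply: eq_from_tnth => i; rewrite !tnth_map.
by rewrite gez0_abs.
Qed.

Lemma nonneg_int_sub n k : nonneg (int_sub n k) ->
  exists2 m, n = map_tuple Posz m & k \in below m.
Proof.
move=> /forallP nk0.
have /nonnegP[m nm] : nonneg n.
  apply/forallP => i; have := nk0 i; rewrite tnth_mktuple subr_ge0.
  exact: le_trans.
exists m => //; rewrite in_below; apply/forallP => i.
by have := nk0 i; rewrite tnth_mktuple nm tnth_map subr_ge0.
Qed.

(** Induction on [p], multiplying by one factor [u] at a time. The vanishing outside the nonnegative
    modes is carried along because it makes the convolution finite: [fourier_mul] applies with
    [below m], as m - k leaves the nonnegative modes for every other [k]. *)
Lemma fourier_pow b u p : power_fourier_sum w b u -> cmeasurable D u ->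
  [/\ cmeasurable D (fun x => u x ^+ p),
      exists M, ae_bounded_by mu D M (fun x => u x ^+ p),
      forall m, fourier w (fun x => u x ^+ p) (map_tuple Posz m) = conv_power b p m
    & forall n, ~~ nonneg n -> fourier w (fun x => u x ^+ p) n = 0].
Proof.
move=> bu mu_; elim: p => [|p [mup [M upM] upE up0]].
  split.
  - exact: cmeasurable_cst.
  - by exists (norm1 (1 : R[i])); apply: ae_bounded_by_everywhere => x _; rewrite expr0.
  - move=> m; rewrite (fourier1 w0)/=; congr (_%:R); congr nat_of_bool.
    by apply: eq_forallb => i; rewrite tnth_map.
  - move=> n n0; rewrite (fourier1 w0); case: (boolP [forall i, _]) => // /forallP n00.
    by move/forallP : n0; case => i; rewrite (eqP (n00 i)).
have uE : (fun x => u x ^+ p.+1) = (fun x => u x * u x ^+ p).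
  by apply/funext => x; rewrite exprS.
rewrite uE; split.
- exact: cmeasurableM.
- have [N uN] := power_fourier_sum_bounded w0 bu.
  by exists (N * M); exact: ae_bounded_byM.
- move=> m; rewrite (fourier_mul w0 (A0 := below m) bu mu_ mup upM); last first.
    move=> k km; apply: up0; apply/negP => /nonneg_int_sub[m' mm' km'].
    move: km; rewrite (_ : m = m') ?km'//.
    apply: eq_from_tnth => i.
    by have /(congr1 (fun t => tnth t i)) := mm'; rewrite !tnth_map => -[].
  by rewrite /= big_seq [RHS]big_seq; apply: eq_bigr => k km; rewrite int_subK// upE.
(* If [n] has a negative entry, so has n - k for every [k]; all terms vanish and the empty set
   serves as [A0]. *)
- move=> n n0; rewrite (fourier_mul w0 (A0 := fset0) bu mu_ mup upM) ?big_seq_fset0//.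
  move=> k _; apply: up0; apply: contra n0 => /nonneg_int_sub[m nm _].
  by apply/nonnegP; exists m.
Qed.

Lemma conv_power1 b m : conv_power b 1 m = b m.
Proof.
rewrite /= (bigD1_seq m) ?fset_uniq//=; last by rewrite in_below; apply/forallP.
rewrite (_ : [forall i, _]) ?mulr1; last first.
  by apply/forallP => i; rewrite tnth_mktuple subnn.
rewrite big_seq_cond big1 ?addr0// => k /andP[]; rewrite in_below => /forallP km kn.
rewrite (_ : [forall i, _] = false) ?mulr0//; apply/negbTE; apply: contra kn.
move=> /forallP mk; apply/eqP; apply: eq_from_tnth => i; apply/eqP.
by have := mk i; rewrite tnth_mktuple subn_eq0 eqn_leq km.
Qed.

(** The case of exponent 1 in [fourier_pow]. It identifies the given coefficients with Fourier
    coefficients, to which Duhamel's formula applies. *)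
Lemma fourier_power_fourier_sum b u m : power_fourier_sum w b u -> cmeasurable D u ->
  fourier w u (map_tuple Posz m) = b m.
Proof.
move=> bu mu_; have [_ _ /(_ m) + _] := fourier_pow 1 bu mu_.
by rewrite conv_power1.
Qed.

End convolution_power.

(** * Linear differential equations *)

Local Notation integral0 := Defs.integral0.

Section complex_ode.
Context {R : realType}.
Variable J : set R.
Hypotheses (oJ : open J) (iJ : is_interval J) (J0 : J 0).
Implicit Types (f g : R -> R[i]) (h : R -> R) (t : R).

Definition rintegral0 h t : R :=
  if 0 <= t then \int[lebesgue_measure]_(x in `[0, t]) h x
  else - \int[lebesgue_measure]_(x in `[t, 0]) h x.

Lemma integral0E f t : integral0 f t =
  rintegral0 (fun x => complex.Re (f x)) t +i* rintegral0 (fun x => complex.Im (f x)) t.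
Proof. by rewrite /integral0 /rintegral0; case: ifP. Qed.

Lemma rintegral0_0 h : rintegral0 h 0 = 0.
Proof. by rewrite /rintegral0 lexx set_itv1 Rintegral_set1. Qed.

Lemma integral0_0 f : integral0 f 0 = 0.
Proof. by rewrite integral0E !rintegral0_0. Qed.

Lemma sub_itv a b : J a -> J b -> `[a, b] `<=` J.
Proof. by move=> Ja Jb z /=; rewrite in_itv/= => abz; exact: iJ Ja Jb _ abz. Qed.

Lemma eq_integral0 f g t : (forall x, J x -> f x = g x) -> J t ->
  integral0 f t = integral0 g t.
Proof.
move=> fg Jt; rewrite /integral0; case: ifP => _.
  by apply: eq_cintegral => x /(sub_itv J0 Jt); exact: fg.
by congr (- _); apply: eq_cintegral => x /(sub_itv Jt J0); exact: fg.
Qed.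

Lemma integrable_sub_itv h a b : (forall x, J x -> {for x, continuous h}) ->
  J a -> J b -> lebesgue_measure.-integrable `[a, b] (EFin \o h).
Proof.
move=> ch Ja Jb; apply: continuous_compact_integrable; first exact: segment_compact.
apply: continuous_in_subspaceT => x; rewrite inE => /(sub_itv Ja Jb) Jx.
exact: ch.
Qed.

Lemma exists_lt t : J t -> exists2 a, J a & a < t.
Proof.
move=> /oJ /nbhs_ballP[e /= e0 eJ]; exists (t - e / 2); last by rewrite ltrBlDr ltrDl divr_gt0.
apply: eJ; rewrite /ball/= opprB addrC subrK gtr0_norm ?divr_gt0//.
by rewrite ltr_pdivrMr// ltr_pMr// ltr1n.
Qed.

Lemma exists_gt t : J t -> exists2 b, J b & t < b.
Proof.
move=> /oJ /nbhs_ballP[e /= e0 eJ]; exists (t + e / 2); last by rewrite ltrDl divr_gt0.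
apply: eJ; rewrite /ball/= opprD addrA subrr add0r normrN gtr0_norm ?divr_gt0//.
by rewrite ltr_pdivrMr// ltr_pMr// ltr1n.
Qed.

(** Openness of [J] provides a segment from [a] to [b] inside [J] with 0 and [t] in its interior.
    Near [t] the signed integral is [F y - F 0] whatever the sign of [y], where [F] integrates from
    [a], so the fundamental theorem for [F] suffices. *)
Lemma is_derive_rintegral0 h t : (forall x, J x -> {for x, continuous h}) -> J t ->
  is_derive t (1 : R) (rintegral0 h) (h t).
Proof.
move=> ch Jt.
have [a Ja] : exists2 a, J a & a < Num.min 0 t.
  by apply: exists_lt; rewrite /Num.min; case: ifP.
rewrite lt_min => /andP[a0 at_].
have [b Jb] : exists2 b, J b & Num.max 0 t < b.
  by apply: exists_gt; rewrite /Num.max; case: ifP.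
rewrite gt_max => /andP[b0 tb].
have ih x y : J x -> J y -> lebesgue_measure.-integrable `[x, y] (EFin \o h).
  exact: integrable_sub_itv.
pose F y := \int[lebesgue_measure]_(x in `[a, y]) h x.
have [dF F'] := continuous_FTC1_closed tb (ih _ _ Ja Jb) at_ (ch _ Jt).
have Ft : is_derive t (1 : R) F (h t) by rewrite -F' derive1E; apply: derivableP.
have FB x y : a <= x -> x <= y -> y <= b ->
    F y - F x = \int[lebesgue_measure]_(z in `[x, y]) h z.
  move=> ax xy yb.
  have Jy : J y by apply: (iJ Ja Jb); rewrite (le_trans ax)//= xy.
  have Jx : J x by apply: (iJ Ja Jb); rewrite ax (le_trans xy).
  rewrite /F Rintegral_itvB//; last exact: ih.
  rewrite Rintegral_itv_obnd_cbnd//.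
  by apply: integrableS (ih _ _ Jx Jy) => //; exact: subset_itv_oc_cc.
apply: (@near_eq_is_derive _ _ _ (fun y => F y - F 0)).
  near=> y.
  have ay : a < y by near: y; exact: lt_nbhsr.
  have yb : y < b by near: y; exact: lt_nbhsl.
  rewrite /rintegral0; case: leP => y0; first by rewrite FB// ltW.
  by rewrite -FB ?ltW// opprB.
by apply: is_derive_eq; rewrite subr0.
Unshelve. all: by end_near. Qed.

(** Derivatives and continuity of complex functions of a real variable are taken componentwise, so
    that real calculus applies directly. *)
Definition is_cderive f t (l : R[i]) :=
  is_derive t (1 : R) (fun x => complex.Re (f x)) (complex.Re l) /\
  is_derive t (1 : R) (fun x => complex.Im (f x)) (complex.Im l).

Definition ccontinuous_at t f :=
  {for t, continuous (fun x => complex.Re (f x))} /\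
  {for t, continuous (fun x => complex.Im (f x))}.

Definition ccontinuous f := forall t, J t -> ccontinuous_at t f.

Lemma ccontinuous_cst c : ccontinuous (fun=> c).
Proof. by move=> t _; split; exact: cvg_cst. Qed.

Lemma ccontinuousD f g : ccontinuous f -> ccontinuous g ->
  ccontinuous (fun x => f x + g x).
Proof.
move=> cf cg t Jt; have [f1 f2] := cf t Jt; have [g1 g2] := cg t Jt.
split; rewrite /prop_for /continuous_at.
  by under eq_fun do rewrite cReD; rewrite cReD; exact: cvgD.
by under eq_fun do rewrite cImD; rewrite cImD; exact: cvgD.
Qed.

Lemma ccontinuousM f g : ccontinuous f -> ccontinuous g ->
  ccontinuous (fun x => f x * g x).
Proof.
move=> cf cg t Jt; have [f1 f2] := cf t Jt; have [g1 g2] := cg t Jt.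
split; rewrite /prop_for /continuous_at.
  under eq_fun do rewrite cReM; rewrite cReM.
  by apply: cvgB; exact: cvgM.
under eq_fun do rewrite cImM; rewrite cImM.
by apply: cvgD; exact: cvgM.
Qed.

Lemma ccontinuousX f n : ccontinuous f -> ccontinuous (fun x => f x ^+ n).
Proof.
move=> cf; elim: n => [|n IH].
  by under eq_fun do rewrite expr0; exact: ccontinuous_cst.
by under eq_fun do rewrite exprS; exact: ccontinuousM.
Qed.

Lemma ccontinuous_sum I (r : seq I) (F : I -> R -> R[i]) :
  (forall i, ccontinuous (F i)) -> ccontinuous (fun x => \sum_(i <- r) F i x).
Proof.
move=> cF; elim: r => [|i r IH].
  by under eq_fun do rewrite big_nil; exact: ccontinuous_cst.
by under eq_fun do rewrite big_cons; exact: ccontinuousD.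
Qed.

Lemma is_cderive_continuous f : (forall t, J t -> exists l, is_cderive f t l) ->
  ccontinuous f.
Proof.
move=> df t /df[l [d1 d2]]; split; apply: differentiable_continuous;
  by apply/derivable1_diffP; apply: ex_derive.
Qed.

Lemma is_cderive_cst (c : R[i]) t : is_cderive (fun=> c) t 0.
Proof. by split; exact: is_derive_cst. Qed.

Lemma is_cderive_id t : is_cderive (fun x => x%:C) t 1.
Proof. by split; [exact: is_derive_id|exact: is_derive_cst]. Qed.

Lemma is_cderiveD f g t l k : is_cderive f t l -> is_cderive g t k ->
  is_cderive (fun x => f x + g x) t (l + k).
Proof.
move=> [f1 f2] [g1 g2]; split.
  by rewrite cReD; under eq_fun do rewrite cReD; exact: is_deriveD.
by rewrite cImD; under eq_fun do rewrite cImD; exact: is_deriveD.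
Qed.

Lemma is_cderiveM f g t l k : is_cderive f t l -> is_cderive g t k ->
  is_cderive (fun x => f x * g x) t (f t * k + l * g t).
Proof.
move=> [f1 f2] [g1 g2]; split.
  under eq_fun do rewrite cReM; apply: is_derive_eq.
  by rewrite cReD !cReM /GRing.scale/=; ring.
under eq_fun do rewrite cImM; apply: is_derive_eq.
by rewrite cImD !cImM /GRing.scale/=; ring.
Qed.

Lemma cexpE (z : R[i]) : cexp z =
  (expR (complex.Re z) * cos (complex.Im z)) +i* (expR (complex.Re z) * sin (complex.Im z)).
Proof. by rewrite /cexp; simpc. Qed.

Lemma is_cderive_cexp f t l : is_cderive f t l ->
  is_cderive (fun x => cexp (f x)) t (l * cexp (f t)).
Proof.
move=> [f1 f2]; rewrite cexpE; split.
  under eq_fun do rewrite cexpE/=; apply: is_derive_eq.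
  by rewrite cReM /GRing.scale/=; ring.
under eq_fun do rewrite cexpE/=; apply: is_derive_eq.
by rewrite cImM /GRing.scale/=; ring.
Qed.

Lemma cexpD (x y : R[i]) : cexp (x + y) = cexp x * cexp y.
Proof.
rewrite !cexpE cReD cImD expRD cosD sinD; simpc; congr (_ +i* _); ring.
Qed.

Lemma cexp0 : cexp 0 = 1 :> R[i].
Proof. by rewrite cexpE/= expR0 cos0 sin0 !mul1r. Qed.

Lemma cexpNK (x : R[i]) : cexp x * cexp (- x) = 1.
Proof. by rewrite -cexpD subrr cexp0. Qed.

Lemma cexpMn (x : R[i]) n : cexp (n%:R * x) = cexp x ^+ n.
Proof.
elim: n => [|n IH]; first by rewrite mul0r cexp0 expr0.
by rewrite -natr1 mulrDl mul1r cexpD IH exprSr.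
Qed.

Lemma is_cderive_integral0 f t : ccontinuous f -> J t ->
  is_cderive (integral0 f) t (f t).
Proof.
move=> cf Jt; split.
  under eq_fun do rewrite integral0E/=.
  by apply: is_derive_rintegral0 => // x /cf[].
under eq_fun do rewrite integral0E/=.
by apply: is_derive_rintegral0 => // x /cf[].
Qed.

Lemma near_J t : J t -> \forall x \near t, J x.
Proof. by move=> Jt; exact: oJ. Qed.

Lemma eq_is_cderive f g t l : (forall x, J x -> f x = g x) -> J t ->
  is_cderive f t l -> is_cderive g t l.
Proof.
move=> fg Jt [f1 f2]; split; [apply: near_eq_is_derive f1|apply: near_eq_is_derive f2].
- by apply: filterS (near_J Jt) => x /fg ->.
- by apply: filterS (near_J Jt) => x /fg ->.
Qed.

Lemma derive0_cst h t : (forall x, J x -> is_derive x (1 : R) h 0) -> J t -> h t = h 0.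
Proof.
move=> dh Jt.
have main a b : a <= b -> J a -> J b -> h b = h a.
  move=> ab Ja Jb; have [x||x _ /eqP] := @MVT_segment _ h (cst 0) a b ab.
  - by move=> /subset_itv_oo_cc /(sub_itv Ja Jb) /dh.
  - apply: derivable_within_continuous => x /(sub_itv Ja Jb) /dh ?.
    exact: ex_derive.
  - by rewrite mul0r subr_eq0 => /eqP.
by have [t0|t0] := leP 0 t; [exact: main|rewrite (main t 0)// ltW].
Qed.

Lemma cderive0_cst f t : (forall x, J x -> is_cderive f x 0) -> J t -> f t = f 0.
Proof.
move=> df Jt; have := derive0_cst (fun x Jx => (df x Jx).1) Jt.
have := derive0_cst (fun x Jx => (df x Jx).2) Jt.
by case: (f t) (f 0) => [a b] [c e] /= -> ->.
Qed.

(** Variation of constants: with the integrating factor [cexp (- integral0 lam x)], the function [h]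
    below has derivative zero, hence is constant on the interval [J]. *)
Lemma linear_ode f lam F t : ccontinuous lam -> ccontinuous F ->
  (forall x, J x -> is_cderive f x (lam x * f x + F x)) -> J t ->
  f t = cexp (integral0 lam t) *
    (f 0 + integral0 (fun x => F x * cexp (- integral0 lam x)) t).
Proof.
move=> clam cF df Jt.
have dE x : J x -> is_cderive (fun x => cexp (- integral0 lam x)) x
    (- lam x * cexp (- integral0 lam x)).
  move=> Jx; apply: is_cderive_cexp.
  have := is_cderiveM (is_cderive_cst (-1) x) (is_cderive_integral0 clam Jx).
  by under eq_fun do rewrite mulN1r; rewrite mul0r addr0 mulN1r.
have cFE : ccontinuous (fun x => F x * cexp (- integral0 lam x)).
  apply: ccontinuousM => //; apply: is_cderive_continuous => x Jx.
  by exists (- lam x * cexp (- integral0 lam x)); exact: dE.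
pose h x := f x * cexp (- integral0 lam x)
  + -1 * integral0 (fun x => F x * cexp (- integral0 lam x)) x.
have h0 : h t = h 0.
  apply: cderive0_cst => // x Jx.
  have := is_cderiveD (is_cderiveM (df x Jx) (dE x Jx))
    (is_cderiveM (is_cderive_cst (-1) x) (is_cderive_integral0 cFE Jx)).
  by congr is_cderive; ring.
move: h0; rewrite /h !integral0_0 oppr0 cexp0 mulr1 mulr0 addr0 => <-.
by rewrite mulN1r subrK mulrCA cexpNK mulr1.
Qed.

End complex_ode.

(** * The triangular system *)

Section quadrature_system.
Context {R : realType} {d : nat}.
Variable J : set R.
Hypotheses (oJ : open J) (iJ : is_interval J) (J0 : J 0).
Variable a : d.-tuple nat -> R -> R[i].
Implicit Types (f g : R -> R[i]) (m k : d.-tuple nat).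
Local Notation quad := (quadrature J).
Local Notation c p m := (fun t => conv_power (a^~ t) p m).

Lemma ccontinuous_within f : ccontinuous J f ->
  {within J, continuous (f : R -> R[i]^o)}.
Proof.
move=> cf; apply: continuous_in_subspaceT => t; rewrite inE => Jt.
have [/cvgrPdist_le c1 /cvgrPdist_le c2] := cf t Jt.
(* The tolerance [e] is itself complex; being positive, it has zero imaginary part and a positive
   real part. *)
apply/cvgrPdist_le => e; rewrite ltcE/= => /andP[/eqP eIm eRe].
have e20 : 0 < complex.Re e / 2 by rewrite divr_gt0.
near=> x; rewrite lecE eIm normc_def/= eqxx/=.
have := normc_le_norm1 (f t - f x); rewrite normc_def => /le_trans; apply.
rewrite [leRHS]splitr /norm1 !(cReD, cImD, cReN, cImN); apply: lerD.
  by near: x; exact: c1.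
by near: x; exact: c2.
Unshelve. all: by end_near. Qed.

Lemma quad_opp f : quad f -> quad (fun t => - f t).
Proof.
by move=> qf; under eq_fun do rewrite -mulN1r; exact: quad_mul (quad_cst _ _) qf.
Qed.

Lemma quad_sum I (r : seq I) (P : pred I) (F : I -> R -> R[i]) :
  (forall i, P i -> quad (F i)) -> quad (fun t => \sum_(i <- r | P i) F i t).
Proof.
move=> qF; elim: r => [|i r IH].
  by under eq_fun do rewrite big_nil; exact: quad_cst.
have [Pi|/negbTE Pi] := boolP (P i).
  by under eq_fun do rewrite big_cons Pi; exact: quad_add (qF i Pi) IH.
by under eq_fun do rewrite big_cons Pi.
Qed.

Lemma quad_exprn f n : quad f -> quad (fun t => f t ^+ n).
Proof.
move=> qf; elim: n => [|n IH].
  by under eq_fun do rewrite expr0; exact: quad_cst.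
by under eq_fun do rewrite exprS; exact: quad_mul.
Qed.

Definition zero_tuple : d.-tuple nat := [tuple 0%N | i < d].

Lemma below_refl m : m \in below m.
Proof. by rewrite in_below; apply/forallP. Qed.

Lemma below_trans k m j : k \in below j -> j \in below m -> k \in below m.
Proof.
rewrite !in_below => /forallP kj /forallP jm; apply/forallP => i.
exact: leq_trans (kj i) (jm i).
Qed.

Lemma zero_tuple_below m : zero_tuple \in below m.
Proof. by rewrite in_below; apply/forallP => i; rewrite tnth_mktuple. Qed.

Lemma below_zero_tuple : below zero_tuple = [fset zero_tuple]%fset.
Proof.
apply/fsetP => k; rewrite in_below !inE; apply/forallP/eqP => [k0|-> //].
apply: eq_from_tnth => i; apply/eqP; have := k0 i.
by rewrite tnth_mktuple leqn0.
Qed.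

Lemma nat_sub_below m k : nat_sub m k \in below m.
Proof. by rewrite in_below; apply/forallP => i; rewrite tnth_mktuple leq_subr. Qed.

Lemma nat_sub0 m : nat_sub m zero_tuple = m.
Proof. by apply: eq_from_tnth => i; rewrite !tnth_mktuple subn0. Qed.

Lemma nat_subnn m : nat_sub m m = zero_tuple.
Proof. by apply: eq_from_tnth => i; rewrite !tnth_mktuple subnn. Qed.

(** Once a nonzero mode [k] is split off from [m], the complementary factor no longer involves the
    mode [m]. This makes the system triangular. *)
Lemma below_nat_sub_lt m k j : k \in below m -> k != zero_tuple ->
  j \in below (nat_sub m k) -> j != m.
Proof.
move=> km k0 jmk; apply: contra k0 => /eqP jm; move: km jmk.
rewrite jm !in_below => /forallP km /forallP mk.
apply/eqP/eq_from_tnth => i; have := mk i; have := km i.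
rewrite !tnth_mktuple => kmi; rewrite leq_subRL// addnC -{2}(addn0 (tnth m i)).
by rewrite leq_add2l leqn0 => /eqP.
Qed.

(** Equality case of a termwise comparison: equal totals would force [k] to be [m]. The total degree
    is the measure for the induction over modes. *)
Lemma sum_below_lt m k : k \in below m -> k != m ->
  (\sum_(i < d) tnth k i < \sum_(i < d) tnth m i)%N.
Proof.
rewrite in_below => /forallP km; apply: contraNT; rewrite -leqNgt => mk.
have /eqP := eqn_leq (\sum_(i < d) tnth k i) (\sum_(i < d) tnth m i)%N.
rewrite mk leq_sum//= => /eqP/eqP/eqP e.
apply/eqP/eq_from_tnth => i.
have /leqif_sum : forall i, true -> (tnth k i <= tnth m i ?= iff (tnth k i == tnth m i))%N.
  by move=> j _; split.
by move=> [_]; rewrite e => /esym/forallP/(_ i)/eqP.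
Qed.

Lemma conv_power0 (b : d.-tuple nat -> R[i]) p : conv_power b p zero_tuple = b zero_tuple ^+ p.
Proof.
elim: p => [|p IH] /=.
  by rewrite expr0 (_ : [forall i, _])//; apply/forallP => i; rewrite tnth_mktuple.
by rewrite below_zero_tuple big_seq_fset1 nat_subnn IH exprS.
Qed.

Lemma quad_conv_power p m : (forall k, k \in below m -> quad (a k)) -> quad (c p m).
Proof.
elim: p m => [|p IH] m qa /=; first exact: quad_cst.
under eq_fun do rewrite big_seq.
apply: quad_sum => k km; apply: quad_mul; first exact: qa.
apply: IH => j jmk; apply: qa; exact: below_trans jmk (nat_sub_below _ _).
Qed.

Lemma ccontinuous_conv_power p m : (forall k, ccontinuous J (a k)) ->
  ccontinuous J (c p m).
Proof.
move=> ca; elim: p m => [|p IH] m /=; first exact: ccontinuous_cst.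
by apply: ccontinuous_sum => k; apply: ccontinuousM.
Qed.

(** Induction on [p], isolating two terms of the convolution. The term at [zero_tuple] is
    [a zero_tuple] times the previous power and contributes p copies of a_0^p a_m; the term at [m]
    contributes one more. All other terms involve only modes below [m] and different from it. *)
Lemma quad_conv_power_rest p m : m != zero_tuple ->
  (forall k, k \in below m -> k != m -> quad (a k)) ->
  quad (fun t => c p m t - p%:R * a zero_tuple t ^+ p.-1 * a m t).
Proof.
move=> m0 qa.
have q0 : quad (a zero_tuple) by apply: qa; [exact: zero_tuple_below|rewrite eq_sym].
elim: p => [|p IH].
  by under eq_fun do rewrite !mul0r subr0; exact: quad_cst.
apply: (@quad_ext _ _ (fun t =>
   a zero_tuple t * (c p m t - p%:R * a zero_tuple t ^+ p.-1 * a m t)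
   + \sum_(k <- ((below m `\ zero_tuple) `\ m)%fset)
       a k t * c p (nat_sub m k) t)); last first.
  move=> t _ /=.
  rewrite (big_fsetD1 zero_tuple) ?zero_tuple_below//= nat_sub0.
  rewrite (big_fsetD1 m)/=; last by rewrite in_fsetD1 m0 below_refl.
  rewrite nat_subnn conv_power0.
  (* For [p] equal to 0 the truncated predecessor makes no difference, the factor [p%:R] being
     zero. *)
  have pE : a zero_tuple t * (p%:R * a zero_tuple t ^+ p.-1 * a m t) =
      p%:R * a zero_tuple t ^+ p * a m t.
    by case: p {IH} => [|p']; rewrite ?mul0r ?mulr0// exprS/=; ring.
  by rewrite mulrBr pE -natr1; ring.
apply: quad_add; first exact: quad_mul.
under eq_fun do rewrite big_seq.
apply: quad_sum => k; rewrite !in_fsetD1 => /and3P[kNm k0 km]; apply: quad_mul; first exact: qa.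
apply: quad_conv_power => j jmk; apply: qa; last exact: below_nat_sub_lt jmk.
exact: below_trans jmk (nat_sub_below _ _).
Qed.

Variables (p : nat) (q : d.-tuple nat -> R).
Hypothesis p2 : (2 <= p)%N.
Hypothesis q0 : q zero_tuple = 0.
Hypothesis ca : forall m, ccontinuous J (a m).
Hypothesis da : forall m t, J t ->
  is_cderive (a m) t ('i%C * (q m)%:C * a m t - 'i%C * c p m t).

(** The nonlinear equation is first read as a linear one whose coefficient [lam] contains the
    unknown. The resulting exponential formula is no quadrature, but it shows that the zero mode
    vanishes either identically or nowhere. *)
Lemma quad_zero_mode : quad (a zero_tuple).
Proof.
pose lam t := - 'i%C * a zero_tuple t ^+ p.-1.
have clam : ccontinuous J lam.
  by apply: ccontinuousM; [exact: ccontinuous_cst|exact: ccontinuousX].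
have a0E t : J t -> a zero_tuple t = cexp (integral0 lam t) * a zero_tuple 0.
  move=> Jt; rewrite (linear_ode oJ iJ J0 clam (@ccontinuous_cst _ J 0) _ Jt); last first.
    move=> x Jx; have := da zero_tuple Jx; congr is_cderive.
    rewrite q0 conv_power0 /lam -[in LHS](prednK (ltnW p2)) exprS.
    by rewrite mulr0 mul0r sub0r addr0; ring.
  congr (_ * _); rewrite -[RHS]addr0; congr (_ + _).
  by under [fun x => _]eq_fun do rewrite mul0r; rewrite /integral0 !cintegral0 oppr0 if_same.
have [a00|a00] := eqVneq (a zero_tuple 0) 0.
  by apply: (quad_ext (quad_cst _ 0)) => t /a0E ->; rewrite a00 mulr0.
(* This is a_0^(1-p), written through the exponential formula so that it can be differentiated by
   the product and chain rules; [hK] confirms the identification. *)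
pose h t := (a zero_tuple 0) ^- p.-1 * cexp (p.-1%:R * (-1 * integral0 lam t)).
have hK t : J t -> h t * a zero_tuple t ^+ p.-1 = 1.
  move=> Jt; rewrite /h cexpMn mulN1r (a0E _ Jt) [(_ * a zero_tuple 0) ^+ _]exprMn.
  have E : cexp (integral0 lam t) ^+ p.-1 * cexp (- integral0 lam t) ^+ p.-1 = 1.
    by rewrite -exprMn cexpNK expr1n.
  have AC (x1 x2 x3 x4 : R[i]) : x1 * x2 * (x3 * x4) = x3 * x2 * (x4 * x1) by ring.
  by rewrite AC E mul1r mulfV// expf_neq0.
have dh t : J t -> is_cderive h t ('i%C * p.-1%:R).
  move=> Jt.
  have := is_cderiveM (is_cderive_cst ((a zero_tuple 0) ^- p.-1) t) (is_cderive_cexp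
    (is_cderiveM (is_cderive_cst p.-1%:R t)
      (is_cderiveM (is_cderive_cst (-1) t) (is_cderive_integral0 oJ iJ J0 clam Jt)))).
  congr is_cderive; transitivity (p.-1%:R * (-1 * lam t) * h t).
    by rewrite /h; ring.
  by rewrite -[RHS]mulr1 -[X in _ = _ * X](hK t Jt) /lam; ring.
have hE t : J t -> h t = (a zero_tuple 0) ^- p.-1 + 'i%C * p.-1%:R * t%:C.
  move=> Jt; have dhN x : J x -> is_cderive (fun x => h x + - ('i%C * p.-1%:R) * x%:C) x 0.
    move=> Jx; have := is_cderiveD (dh x Jx)
      (is_cderiveM (is_cderive_cst (- ('i%C * p.-1%:R)) x) (is_cderive_id x)).
    by congr is_cderive; ring.
  have := cderive0_cst iJ J0 dhN Jt.
  have -> : h 0 = (a zero_tuple 0) ^- p.-1 by rewrite /h integral0_0 !mulr0 cexp0 mulr1.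
  by rewrite rmorph0 mulr0 addr0 => <-; rewrite mulNr subrK.
have qh : quad h.
  apply: quad_ext hE; apply: quad_add; first exact: quad_cst.
  by apply: quad_mul; [exact: quad_cst|exact: quad_id].
have h0 t : J t -> h t != 0.
  move=> Jt; apply/eqP => ht; have /eqP := hK t Jt.
  by rewrite ht mul0r eq_sym oner_eq0.
(* The zero mode is itself the required continuous branch of the root of [1 / h]. *)
apply: (@quad_root _ _ p.-1 (fun t => 1 / h t)).
- exact: quad_div (quad_cst _ _) qh h0.
- by move=> t Jt; rewrite mulf_neq0 ?oner_eq0// invr_eq0 h0.
- by rewrite -ltnS prednK// ltnW.
- exact/ccontinuous_within.
- by move=> t Jt; rewrite -(hK t Jt) mulrAC mulfV ?mul1r// h0.
Qed.

(** Strong induction on the total degree. After removal of the part linear in a_m, the forcing term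
    [rest] is a quadrature by induction, and [linear_ode] gives a_m. *)
Lemma quad_modes m : quad (a m).
Proof.
have [N] := ubnP (\sum_(i < d) tnth m i)%N; elim: N m => // N IH m; rewrite ltnS => mN.
have [->|m0] := eqVneq m zero_tuple; first exact: quad_zero_mode.
have qlt k : k \in below m -> k != m -> quad (a k).
  by move=> km kNm; apply: IH; exact: leq_trans (sum_below_lt km kNm) mN.
pose rest t := c p m t - p%:R * a zero_tuple t ^+ p.-1 * a m t.
(* The coefficient of a_m collects the dispersion term and the linear part of the nonlinearity; it
   involves the zero mode only. *)
pose lam t := 'i%C * (q m)%:C + - 'i%C * p%:R * a zero_tuple t ^+ p.-1.
have clam : ccontinuous J lam.
  apply: ccontinuousD; first exact: ccontinuous_cst.
  by apply: ccontinuousM; [exact: ccontinuous_cst|exact: ccontinuousX].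
have qlam : quad lam.
  apply: quad_add; first exact: quad_cst.
  apply: quad_mul; first exact: quad_cst.
  exact/quad_exprn/quad_zero_mode.
have crest : ccontinuous J (fun t => - 'i%C * rest t).
  apply: ccontinuousM; first exact: ccontinuous_cst.
  apply: ccontinuousD; first exact: ccontinuous_conv_power.
  rewrite (_ : (fun t => _) = (fun t => (- p%:R) * a zero_tuple t ^+ p.-1 * a m t)).
    apply: ccontinuousM => //; apply: ccontinuousM; first exact: ccontinuous_cst.
    exact: ccontinuousX.
  by apply/funext => t; rewrite !mulNr.
have qrest : quad (fun t => - 'i%C * rest t).
  by apply: quad_mul; [exact: quad_cst|exact: quad_conv_power_rest].
apply: (quad_ext (f := fun t => cexp (integral0 lam t) *
  (a m 0 + integral0 (fun x => - 'i%C * rest x * cexp (- integral0 lam x)) t))); last first.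
  move=> t Jt; apply: (linear_ode oJ iJ J0 clam crest _ Jt) => x Jx.
  by have := da m Jx; congr is_cderive; rewrite /lam /rest; ring.
apply: quad_mul; first exact/quad_exp/quad_integral.
apply: quad_add; first exact: quad_cst.
apply: quad_integral; apply: quad_mul => //.
exact/quad_exp/quad_opp/quad_integral.
Qed.

End quadrature_system.

(** * Control of single Fourier coefficients by the Wiener norm *)

Section wiener.
Context {R : realType} {d : nat}.
Variable w : d.-tuple R.
Hypothesis w0 : forall i, tnth w i != 0.
Local Notation mu := (lebesgue_euclid R d).
Local Notation D := (fundamental_domain w).

(** The norm dominates each of its terms, and the weight is at least 1 because [s] is nonnegative;
    the 2 compares [norm1] with the modulus. *)
Lemma norm1_fourier_le (s : R) (v : euclid R d -> R[i]) n : 0 <= s ->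
  ((norm1 (fourier w v n) / 2)%:E <= wiener_norm w s v)%E.
Proof.
move=> s0; apply: esum_ge; exists [set n]; first by split.
have z0 : 0 <= complex.Re `|fourier w v n| by rewrite normc_def /= sqrtr_ge0.
rewrite fsbig_set1 lee_fin ler_pdivrMr// mulrC.
apply: le_trans (norm1_le_normc _) _; rewrite ler_wpM2l// ler_peMl//.
rewrite -[X in X <= _](powRr0 (1 + (size1 n)%:R)).
by apply: ler_powR => //; rewrite lerDl.
Qed.

Lemma fourierB (u v : euclid R d -> R[i]) M N n :
  cmeasurable D u -> ae_bounded_by mu D M u ->
  cmeasurable D v -> ae_bounded_by mu D N v ->
  fourier w (fun x => u x - v x) n = fourier w u n - fourier w v n.
Proof.
move=> mu_ uM mv vN; have mD := measurable_fundamental_domain w.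
have iu := cintegrable_mul_cis n mu_ uM; have iv := cintegrable_mul_cis n mv vN.
rewrite !fourierE -mulrBr; congr (_ * _).
rewrite -[X in _ - X]mul1r -mulNr -(cintegralZ mD)//.
rewrite -cintegralD//; last exact: cintegrableZ.
by apply: eq_cintegral => x _; ring.
Qed.

End wiener.

(** * From Duhamel's formula to the triangular system *)

Lemma integral0Z (R : realType) (J : set R) (c : R[i]) (f : R -> R[i]) (t : R) :
  is_interval J -> J 0 -> ccontinuous J f -> J t ->
  integral0 (fun x => c * f x) t = c * integral0 f t.
Proof.
move=> iJ J0 cf Jt.
have i x y : J x -> J y -> cintegrable lebesgue_measure `[x, y] f.
  by move=> Jx Jy; split; apply: (integrable_sub_itv iJ _ Jx Jy) => z /cf[].
rewrite /integral0; case: ifP => _; first by rewrite cintegralZ//; exact: i.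
by rewrite cintegralZ ?mulrN//; exact: i.
Qed.

Theorem theorem1p2 (R : realType) (d p : nat) (hd : (1 <= d)%N)
    (hp : (2 <= p)%N) (w : d.-tuple R) (hw : forall i, tnth w i != 0)
    (s : R) (hs : 0 <= s)
    (u0 : euclid R d -> R[i]) (hu0 : wiener_plus w s u0)
    (Tmin Tmax : \bar R) (u : R -> euclid R d -> R[i])
    (hu : maximal_solution w p s u0 [set t | (- Tmin < t%:E < Tmax)%E] u)
    (a : d.-tuple nat -> R -> R[i])
    (ha : forall t, (- Tmin < t%:E < Tmax)%E ->
            power_fourier_sum w (fun n => a n t) (u t)) :
  forall n, quadrature [set t | (- Tmin < t%:E < Tmax)%E] (a n).
Proof.
have [[[iJ J0] Hw Hc HD] _] := hu; move: iJ J0 Hw Hc HD.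
have : forall t, [set t | (- Tmin < t%:E < Tmax)%E] t ->
  power_fourier_sum w (fun n => a n t) (u t) by [].
have : open [set t | (- Tmin < t%:E < Tmax)%E].
  rewrite (_ : [set t | _] = [set t | (- Tmin < t%:E)%E] `&` [set t | (t%:E < Tmax)%E]).
    by apply: openI; [exact: open_ereal_gt|exact: open_ereal_lt].
  by apply/seteqP; split => t /= => [/andP[]|[-> ->]].
(* The concrete interval is abstracted to an open interval [J] containing 0. *)
move: [set t | _] => J oJ {}ha iJ J0 Hw Hc HD.
have mu_ t : J t -> cmeasurable (fundamental_domain w) (u t).
  by move=> /Hw[[_ /cintegrable_measurable]].
pose q m := freq2 w (map_tuple Posz m).
have aE m t : J t -> fourier w (u t) (map_tuple Posz m) = a m t.
  by move=> Jt; exact: (fourier_power_fourier_sum hw m (ha t Jt) (mu_ t Jt)).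
(* Continuity of the solution in the Wiener norm passes to each coefficient, the norm of
   [u t - u t0] bounding the coefficient of the difference. *)
have ca m : ccontinuous J (a m).
  move=> t0 Jt0.
  have near_le (e : R) : 0 < e -> \forall t \near t0, norm1 (a m t0 - a m t) <= e.
    move=> e0; have e20 : (0 < (e / 2)%:E)%E by rewrite lte_fin divr_gt0.
    have := Hc t0 Jt0 _ (open_ereal_lt' e20).
    rewrite /= /within => H; near=> t.
    have Jt : J t by near: t; exact: oJ.
    have [M uM] := power_fourier_sum_bounded hw (ha t Jt).
    have [N uN] := power_fourier_sum_bounded hw (ha t0 Jt0).
    have lt : (wiener_norm w s (fun x => u t x - u t0 x)%R < (e / 2)%:E)%E.
      by move: Jt {M uM N uN}; near: t.
    have := le_lt_trans (norm1_fourier_le w _ (map_tuple Posz m) hs) lt.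
    rewrite (fourierB (map_tuple Posz m) (mu_ t Jt) uM (mu_ t0 Jt0) uN) !aE//.
    by rewrite lte_fin ltr_pM2r ?invr_gt0// -norm1N opprB => /ltW.
  split; apply/cvgrPdist_le => e /near_le; apply: filterS => t.
    by apply: le_trans; rewrite -cReN -cReD Re_le_norm1.
  by apply: le_trans; rewrite -cImN -cImD Im_le_norm1.
have q0 : q (zero_tuple : d.-tuple nat) = 0.
  by apply: big1 => i _; rewrite tnth_map tnth_mktuple expr0n/= mulr0.
apply: (quad_modes oJ iJ J0 hp q0 ca) => m t Jt.
(* The kernel exp(k (t - tau)) of Duhamel's formula factors into exp(k t) and exp(-k tau). With the
   second factor placed in [g], the integrand no longer depends on [t] and the integral can be
   differentiated. *)
pose k : R[i] := 'i%C * (q m)%:C.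
pose g x := cexp (- k * x%:C) * conv_power (a^~ x) p m.
have dexp (c : R[i]) x : is_cderive (fun x => cexp (c * x%:C)) x (c * cexp (c * x%:C)).
  have := is_cderive_cexp (is_cderiveM (is_cderive_cst c x) (is_cderive_id x)).
  by rewrite mulr1 mul0r addr0.
have cg : ccontinuous J g.
  apply: ccontinuousM; last exact: ccontinuous_conv_power.
  by apply: is_cderive_continuous => x _; exists (- k * cexp (- k * x%:C)).
have duhamel x : J x -> cexp (k * x%:C) * (a m 0 + - 'i%C * integral0 g x) = a m x.
  have kE y z : 'i%C * (q m * (y - z))%:C = k * y%:C + - k * z%:C :> R[i].
    by rewrite /k rmorphM rmorphB; ring.
  (* The initial condition is Duhamel's formula at time 0, where the integral vanishes. *)
  have u0E : fourier w u0 (map_tuple Posz m) = a m 0.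
    by rewrite -aE// HD// integral0_0 !mulr0 subr0 cexp0 mul1r.
  move=> Jx; rewrite -[RHS]aE// HD// u0E -[X in X * a m 0](_ : cexp (k * x%:C) = _); last first.
    by rewrite /k rmorphM mulrA.
  rewrite [in RHS](eq_integral0 iJ J0 (g := fun y => cexp (k * x%:C) * g y))
    ?(integral0Z _ iJ)//.
    by ring.
  move=> y Jy; rewrite -/(q m) kE cexpD /g mulrA.
  by have [_ _ -> _] := fourier_pow hw p (ha y Jy) (mu_ y Jy).
have da := is_cderiveM (dexp k t) (is_cderiveD (is_cderive_cst (a m 0) t)
  (is_cderiveM (is_cderive_cst (- 'i%C) t) (is_cderive_integral0 oJ iJ J0 cg Jt))).
(* Differentiating the factored formula: the exponential reproduces k a_m, and in the integral term
   the two exponentials cancel, leaving the convolution. *)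
have := eq_is_cderive oJ duhamel Jt da; congr is_cderive.
rewrite add0r mul0r addr0 -mulrA duhamel// -/k addrC; congr (_ + _).
have E : cexp (k * t%:C) * cexp (- k * t%:C) = 1 by rewrite mulNr cexpNK.
by rewrite /g mulrCA [cexp _ * (cexp _ * _)]mulrA E mul1r mulNr.
Unshelve. all: by end_near. Qed.
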